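(* For any $0<\eta<1/2$ there exists $K>0$ such that for all sufficiently large $d$, every $(n,d,\lambda)$-graph $G$ with $d\geq K\lambda$ contains a $K_{(1-5\eta)d}$-immersion.
   Context: An $(n,d,\lambda)$-graph is an $n$-vertex $d$-regular graph all of whose adjacency eigenvalues except the largest one are at most $\lambda$ in absolute value. A graph $G$ contains an $H$-immersion if there is an injective map $\phi:V(H)\to V(G)$ and, for every edge $uv\in E(H)$, a path $P_{uv}$ in $G$ from $\phi(u)$ to $\phi(v)$, such that the paths $P_{uv}$ ($uv\in E(H)$) are pairwise edge-disjoint. Floors are omitted ($K_{(1-5\eta)d}$ means $K_{\lfloor(1-5\eta)d\rfloor}$). *)

(* Defs.v *)
From mathcomp Require Import all_boot all_order all_algebra.
From mathcomp Require Import reals.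
Set Implicit Arguments. Unset Strict Implicit. Unset Printing Implicit Defensive.
Import Order.TTheory GRing.Theory Num.Theory.
Local Open Scope ring_scope.

Definition simple_graph (n : nat) (e : rel 'I_n) : Prop :=
  symmetric e /\ irreflexive e.

Definition regular (n : nat) (e : rel 'I_n) (d : nat) : Prop :=
  forall v : 'I_n, #|[set w | e v w]| = d.

Definition adjmx (R : realType) (n : nat) (e : rel 'I_n) : 'M[R]_n :=
  \matrix_(i, j) (e i j)%:R.

Definition spectral_cond (R : realType) (n : nat) (e : rel 'I_n) (lam : R) : Prop :=
  exists mu : 'I_n -> R,
    char_poly (adjmx R e) = \prod_(i < n) ('X - (mu i)%:P) /\
    (exists i0 : 'I_n,
       (forall i, mu i <= mu i0) /\ (forall i, i != i0 -> `|mu i| <= lam)).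

Definition ndl_graph (R : realType) (n d : nat) (lam : R) (e : rel 'I_n) : Prop :=
  simple_graph e /\ regular e d /\ spectral_cond e lam.

Definition is_path (n : nat) (e : rel 'I_n) (x y : 'I_n) (p : seq 'I_n) : Prop :=
  path e x p /\ uniq (x :: p) /\ last x p = y.

Definition path_edges (n : nat) (x : 'I_n) (p : seq 'I_n) : seq {set 'I_n} :=
  [seq [set ab.1; ab.2] | ab <- zip (x :: p) p].

Definition has_Kimmersion (n : nat) (e : rel 'I_n) (m : nat) : Prop :=
  exists (phi : 'I_m -> 'I_n) (P : 'I_m -> 'I_m -> seq 'I_n),
    injective phi /\
    (forall u v : 'I_m, (u < v)%N -> is_path e (phi u) (phi v) (P u v)) /\
    (forall u v u' v' : 'I_m, (u < v)%N -> (u' < v')%N -> (u, v) != (u', v') ->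
       forall f, f \in path_edges (phi u) (P u v) ->
                 f \notin path_edges (phi u') (P u' v')).

(* Main.v *)
(* The spectral gap gives, by diagonalising the adjacency matrix over the complex
   numbers, sum_x (deg_S(x) - d|S|/n)^2 <= lam^2 |S| for every vertex set S.  Fix
   a set M of (1 - 5 eta) d branch vertices and route the pairs in M one by one
   through edge-disjoint paths; adjacent pairs use their own edge.

   If n >= C d, join u, v in M by two short trees grown from u and v until both
   reach a constant proportion of the vertices; some unused edge then joins them,
   and only the arcs of one path are kept. The trees grow by the
   Friedman-Pippenger technique, applied to arc sets so that every vertex may be
   reused a bounded number of times: an arc set is extendable if it satisfies a
   Hall-type condition on sets of at most 2 m0 vertices; extendability passes to
   subsets, and any vertex whose demand is unmet has an arc preserving it.

   If n <= C d, take the vertices w outside M one after the other and match almost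
   all of N(w) \cap M by not yet routed pairs u, v, using the paths u, w, v. The
   graph of unrouted pairs is quasirandom, so Hall's theorem with deficiency
   applies to a near-balanced bipartition of it. The accumulated error stays
   bounded by a Gronwall argument, and the few pairs left over are joined by paths
   of length three whose middle edge avoids M. *)

Require Import Defs.
From mathcomp Require Import all_boot all_order all_fingroup all_algebra.
From mathcomp Require Import reals complex spectral sequences exp.
From mathcomp Require Import zify ring lra.
Set Implicit Arguments. Unset Strict Implicit. Unset Printing Implicit Defensive.
Import Order.TTheory GRing.Theory Num.Theory.

(** A branch vertex of degree d must start almost (1 - 5 eta) d edge-disjoint paths, so about 5 eta
    d of its edges are spare; all local losses are charged to this slack. The threshold C separates
    two kinds of scarcity. A path built from trees costs of the order of log (n/d) edges, so about
    d^2 / 2 of them fit among n d / 2 edges only if n is much larger than d. For n <= C d the supply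
    of edges may be just a constant multiple of the number of pairs, which forces paths of length
    two for almost all nonadjacent pairs; in return the density d/n is at least 1/C, and mixing
    errors become small multiples of n^2, at the price of a K exponential in C^3 / eta^2. In the
    sparse case a vertex outside M with too many neighbours in M could not be relied on to branch,
    because trees never enter M. Such vertices ([Dead]) are excluded altogether; by the spectral
    bound they number at most eta d / 2. *)

Definition degin (T : finType) (e : rel T) (S : {set T}) (x : T) : nat :=
  #|[set y in S | e x y]|.

(** * Expansion-preserving embedding (Friedman-Pippenger) *)

Section Extendability.
Variables (T : finType) (e : rel T) (kap dem : T -> nat) (Src : {set T}).
Variables (m0 N : nat).
Implicit Types (F : {set T * T}) (U X : {set T}) (x y s : T).

Definition indeg F y := #|[set x | (x, y) \in F]|.
Definition outdeg F x := #|[set y | (x, y) \in F]|.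
Definition freedeg F U y := #|[set x in U | e x y && ((x, y) \notin F)]|.
Definition room F U := \sum_y minn (kap y - indeg F y) (freedeg F U y).

(* [dem x] arcs are to leave [x] in total, and at most [kap y] may enter [y];
   [room F U] bounds the number of arcs from [U] that can still be added to [F]. *)
Definition extendable F :=
  [forall U : {set T}, (U \subset Src) && (#|U| <= 2 * m0) ==>
     (\sum_(x in U) dem x <= room F U + \sum_(x in U) outdeg F x)].

Lemma extendableP F : reflect
  (forall U, U \subset Src -> #|U| <= 2 * m0 ->
     \sum_(x in U) dem x <= room F U + \sum_(x in U) outdeg F x) (extendable F).
Proof.
apply: (iffP forallP) => [h U sU cU | h U]; first by have := h U; rewrite sU cU.
by apply/implyP => /andP[]; apply: h.
Qed.

Lemma sum_indeg F : \sum_y indeg F y = #|F|.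
Proof.
rewrite -sum1_card (partition_big snd predT) //=; apply: eq_bigr => y _.
rewrite /indeg -sum1_card.
rewrite (reindex_onto (fun x => (x, y)) fst) /=; last by move=> [a b] /= /andP[_ /eqP ->].
by apply: eq_bigl => x; rewrite inE !eqxx !andbT.
Qed.

Lemma sum_outdeg F U :
  \sum_(x in U) outdeg F x = \sum_y #|[set x in U | (x, y) \in F]|.
Proof.
have cE (A : {set T}) (P : pred T) : #|[set x in A | P x]| = \sum_(x in A) P x.
  by rewrite -sum1_card [RHS]big_mkcond [LHS]big_mkcond;
     apply: eq_bigr => x _; rewrite inE; case: (x \in A); case: (P x).
under [RHS]eq_bigr do rewrite cE.
rewrite exchange_big /=; apply: eq_bigr => x _.
rewrite /outdeg -sum1_card big_mkcond; apply: eq_bigr => y _.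
by rewrite inE; case: (_ \in F).
Qed.

(** At a head [y] the arcs of [F] lower both arguments of the minimum by at most [indeg F y].
    Together with [bigU] this keeps sets of size between [m0] and [2 * m0] from being tight as long
    as [F] has at most [N] arcs. *)
Lemma room0_le F U : room set0 U <= room F U + #|F|.
Proof.
rewrite -sum_indeg -big_split /=; apply: leq_sum => y _.
have -> : indeg set0 y = 0 by rewrite /indeg; apply: eq_card0 => x; rewrite !inE.
have : freedeg set0 U y <= freedeg F U y + indeg F y.
  rewrite /freedeg /indeg; apply: leq_trans (leq_card_setU _ _).
  by apply: subset_leq_card; apply/subsetP => x; rewrite !inE; case: (_ \in F); rewrite ?andbT ?orbT ?andbF ?orbF.
lia.
Qed.

Lemma freedegU F U V y :
  freedeg F (U :|: V) y + freedeg F (U :&: V) y = freedeg F U y + freedeg F V y.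
Proof.
rewrite /freedeg -[RHS]cardsUI; congr (_ + _).
  by apply: eq_card => x; rewrite !inE; case: (x \in U); case: (x \in V); rewrite ?orbF ?orbb.
by apply: eq_card => x; rewrite !inE; case: (x \in U); case: (x \in V); rewrite ?andbF ?andbb.
Qed.

Lemma freedegS F U (V : {set T}) y : U \subset V -> freedeg F U y <= freedeg F V y.
Proof.
move=> sUV; apply: subset_leq_card; apply/subsetP => x; rewrite !inE.
by case/andP => /(subsetP sUV) ->.
Qed.

(** Head by head: the minimum of a constant and a monotone additive function of [U] is
    submodular. *)
Lemma room_submod F U V : room F (U :|: V) + room F (U :&: V) <= room F U + room F V.
Proof.
rewrite /room -!big_split; apply: leq_sum => y _ /=.
have := freedegU F U V y.
have := freedegS F y (subsetIl U V); have := freedegS F y (subsetIr U V).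
lia.
Qed.

Lemma sum_setUI (f : T -> nat) U V :
  \sum_(x in U :|: V) f x + \sum_(x in U :&: V) f x
    = \sum_(x in U) f x + \sum_(x in V) f x.
Proof.
rewrite ![\sum_(x in _) _]big_mkcond -!big_split; apply: eq_bigr => x _ /=.
by rewrite !inE; case: (x \in U); case: (x \in V); rewrite ?addn0.
Qed.

(** At each head the deleted arcs out of [U] cost [r1] in out-degree, while the free degree regains
    [r1] and the residual capacity regains [r >= r1]. The bound [indeg F y <= kap y] keeps the
    truncated subtraction exact. *)
Lemma extendable_sub F F' : F' \subset F -> (forall x y, (x, y) \in F -> e x y) ->
  (forall y, indeg F y <= kap y) -> extendable F -> extendable F'.
Proof.
move=> sF Fe Fk /extendableP h; apply/extendableP => U sU cU.
apply: leq_trans (h U sU cU) _; rewrite !sum_outdeg /room -!big_split /=.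
apply: leq_sum => y _; move: (Fk y).
set r := #|[set x | (x, y) \in F :\: F']|.
set r1 := #|[set x in U | (x, y) \in F :\: F']|.
have -> : indeg F y = indeg F' y + r.
  rewrite /indeg /r -cardsUI [X in _ + X]eq_card0 ?addn0.
    apply: eq_card => x; rewrite !inE.
    by have := subsetP sF (x, y); case: (_ \in F') => [/(_ isT) ->|_].
  by move=> x; rewrite !inE; case: (_ \in F').
have -> : #|[set x in U | (x, y) \in F]| = #|[set x in U | (x, y) \in F']| + r1.
  rewrite /r1 -cardsUI [X in _ + X]eq_card0 ?addn0.
    apply: eq_card => x; rewrite !inE.
    by have := subsetP sF (x, y); case: (_ \in F') => [/(_ isT) ->|_] /=; rewrite ?andbT ?andbF ?orbF.
  by move=> x; rewrite !inE; case: (_ \in F'); rewrite ?andbF.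
have -> : freedeg F' U y = freedeg F U y + r1.
  rewrite /freedeg /r1 -cardsUI [X in _ + X]eq_card0 ?addn0.
    apply: eq_card => x; rewrite !inE.
    have := subsetP sF (x, y); have := Fe x y.
    case: (_ \in F); last by move=> _; case: (_ \in F') => [/(_ isT)//|_]; rewrite !andbF orbF.
    by move=> /(_ isT) -> _; case: (_ \in F'); rewrite ?andbF ?andbT.
  by move=> x; rewrite !inE; case: (_ \in F); rewrite ?andbF.
have : r1 <= r by apply: subset_leq_card; apply/subsetP => x; rewrite !inE => /andP[].
clearbody r r1. move: #|_| (freedeg _ _ _) (indeg _ _) (kap _) => a b c0 d0. lia.
Qed.

Hypothesis m0_gt0 : 0 < m0.
Hypothesis bigU : forall U, U \subset Src -> m0 <= #|U| <= 2 * m0 ->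
  \sum_(x in U) dem x + N < room set0 U.

Section Step.
Variables (F : {set T * T}) (s : T) (X : {set T}).
Hypotheses (extF : extendable F) (FN : #|F| <= N) (sS : s \in Src).
Hypothesis dem_s :
  outdeg F s + #|[set y in X | e s y && ((s, y) \notin F)]| < dem s.

(** By [extF] the inequality is an equality: these are the critical sets. Sizes below [m0] leave
    room for the union of two of them. *)
Let tight U := [&& U \subset Src, #|U| < m0 &
  room F U + \sum_(x in U) outdeg F x <= \sum_(x in U) dem x].

Let tight_small U : U \subset Src -> #|U| <= 2 * m0 ->
  room F U + \sum_(x in U) outdeg F x <= \sum_(x in U) dem x -> #|U| < m0.
Proof.
move=> sU cU tU; rewrite ltnNge; apply/negP => mU.
have := bigU sU; rewrite mU cU => /(_ isT); have := room0_le F U; lia.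
Qed.

(** Uncrossing: submodularity of [room] and extendability at [U :&: V] force equality at the union,
    whose size is below [2 * m0]; [tight_small] then brings it back below [m0]. *)
Let tightU U V : tight U -> tight V -> tight (U :|: V).
Proof.
move=> /and3P[sU cU tU] /and3P[sV cV tV].
have sUV : U :|: V \subset Src by rewrite subUset sU.
have cUV : #|U :|: V| <= 2 * m0 by have [+ _] := leq_card_setU U V; lia.
have tUV : room F (U :|: V) + \sum_(x in U :|: V) outdeg F x
             <= \sum_(x in U :|: V) dem x.
  have sI : U :&: V \subset Src by apply: subset_trans sU; apply: subsetIl.
  have cI : #|U :&: V| <= 2 * m0 by have := subset_leq_card (subsetIl U V); lia.
  have := extendableP _ extF _ sI cI; have := room_submod F U V.
  have := sum_setUI dem U V; have := sum_setUI (outdeg F) U V; lia.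
by rewrite /tight sUV tUV tight_small.
Qed.

Let maxtight := \bigcup_(U : {set T} | tight U && (s \notin U)) U.

Let maxtightP : tight maxtight && (s \notin maxtight).
Proof.
rewrite /maxtight; apply: (big_ind (fun U => tight U && (s \notin U))) => //.
  rewrite inE andbT /tight sub0set cards0 m0_gt0 /= !big_set0 addn0 leqn0.
  rewrite sum_nat_eq0; apply/forallP => y; apply/implyP => _.
  rewrite -leqn0; apply: leq_trans (geq_minr _ _) _; rewrite leqn0 cards_eq0.
  by apply/eqP/setP => x; rewrite !inE.
move=> U V /andP[tU sU] /andP[tV sV]; rewrite tightU //=.
by rewrite inE negb_or sU.
Qed.

Let blocked y : e s y -> (s, y) \notin F -> indeg F y < kap y ->
  ~~ extendable ((s, y) |: F) -> kap y - indeg F y <= freedeg F maxtight y.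
Proof.
move=> esy syF ky; rewrite negb_forall => /existsP[U].
rewrite negb_imply -ltnNge => /andP[/andP[sU cU]].
have inE' z : indeg ((s, y) |: F) z = indeg F z + (z == y).
  rewrite /indeg; case: eqVneq => [->|zy] /=; last first.
    by rewrite addn0; apply: eq_card => x; rewrite !inE xpair_eqE (negPf zy) andbF.
  transitivity #|s |: [set x | (x, y) \in F]|; last by rewrite cardsU1 inE syF addnC.
  apply: eq_card => x.
  by rewrite !inE xpair_eqE eqxx andbT.
have outE x : outdeg ((s, y) |: F) x = outdeg F x + (x == s).
  rewrite /outdeg; case: eqVneq => [->|zy] /=; last first.
    by rewrite addn0; apply: eq_card => z; rewrite !inE xpair_eqE (negPf zy).
  transitivity #|y |: [set z | (s, z) \in F]|; last by rewrite cardsU1 inE syF addnC.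
  apply: eq_card => z.
  by rewrite !inE xpair_eqE eqxx.
have frE z : freedeg F U z = freedeg ((s, y) |: F) U z + ((s \in U) && (z == y)).
  rewrite /freedeg; case: eqVneq => [->|zy]; last first.
    rewrite andbF addn0; apply: eq_card => x.
    by rewrite !inE xpair_eqE (negPf zy) andbF.
  case: (boolP (s \in U)) => /= sU'; last first.
    rewrite addn0; apply: eq_card => x.
    by rewrite !inE xpair_eqE eqxx andbT; case: eqVneq => // ->; rewrite (negPf sU').
  rewrite (cardsD1 s) inE sU' esy syF /= addnC; congr (_ + _).
  apply: eq_card => x; rewrite !inE xpair_eqE eqxx andbT.
  by case: eqVneq => //=; rewrite ?andbF.
have -> : \sum_(x in U) outdeg ((s, y) |: F) x = \sum_(x in U) outdeg F x + (s \in U).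
  under eq_bigr do rewrite outE.
  rewrite big_split /=; congr (_ + _).
  case: (boolP (s \in U)) => sU'.
    by rewrite (bigD1 s) //= eqxx big1 // => x /andP[_ /negPf ->].
  by rewrite big1 // => x xU; case: eqVneq => // xs; rewrite -xs xU in sU'.
have := extendableP _ extF _ sU cU.
have roomE G : room G U = minn (kap y - indeg G y) (freedeg G U y)
    + \sum_(i | i != y) minn (kap i - indeg G i) (freedeg G U i).
  by rewrite /room (bigD1 y).
rewrite !roomE; set A := \sum_(i | i != y) minn (kap i - indeg F i) _.
have -> : \sum_(i | i != y) minn (kap i - indeg ((s, y) |: F) i) (freedeg ((s, y) |: F) U i) = A.
  apply: eq_bigr => z zy; rewrite inE' frE (negPf zy) andbF !addn0 //.
rewrite inE' (frE y) eqxx andbT => h1 h2.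
(* If [s] is in [U], the new arc adds one to the out-degrees and lowers the [y]-term by at most one,
   so the inequality for [U] cannot break. *)
have [sU' | sU'] := boolP (s \in U); first by move: h1 h2; rewrite sU'; clear; lia.
move: h1 h2; rewrite (negPf sU') /= !addn0 => h1 h2.
(* If [s] is outside [U], a violation means that the drop in capacity was felt: the minimum at [y]
   was the residual capacity, and [U] was already tight. *)
have h3 : kap y - indeg F y <= freedeg F U y.
  by rewrite frE (negPf sU') /= addn0; move: h1 h2; clear; lia.
have tU : room F U + \sum_(x in U) outdeg F x <= \sum_(x in U) dem x.
  by rewrite roomE -/A frE (negPf sU') /= addn0; move: h1 h2; clear; lia.
apply: leq_trans h3 (freedegS _ _ _); apply: bigcup_sup.
by rewrite /tight sU sU' tU (tight_small sU cU tU).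
Qed.

(* Friedman-Pippenger: if no arc out of [s] could be added, every available
   head would be saturated by the union of the tight sets avoiding [s], and
   adding [s] to this union would violate extendability. *)
Lemma extendable_step : exists y, [/\ y \notin X, e s y, (s, y) \notin F,
  indeg F y < kap y & extendable ((s, y) |: F)].
Proof.
pose good y := [&& y \notin X, e s y, (s, y) \notin F,
  indeg F y < kap y & extendable ((s, y) |: F)].
suff /existsP[y /and5P[]] : [exists y, good y] by exists y.
apply: contraT => /existsPn nogood.
have /andP[/and3P[sU cU tU] sNU] := maxtightP; move: (blocked) sU cU tU sNU.
set U := maxtight => blk sU cU tU sNU.
have sUs : s |: U \subset Src by rewrite subUset sub1set sS.
have cUs : #|s |: U| <= 2 * m0 by rewrite cardsU1 sNU; lia.
have := extendableP _ extF _ sUs cUs; rewrite !big_setU1 //=.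
suff : room F (s |: U) <= room F U + #|[set y in X | e s y && ((s, y) \notin F)]| by lia.
have -> : #|[set y in X | e s y && ((s, y) \notin F)]|
   = \sum_y [&& y \in X, e s y & (s, y) \notin F].
  by rewrite -sum1_card big_mkcond; apply: eq_bigr => y _; rewrite inE; case: ifP.
rewrite /room -big_split; apply: leq_sum => y _ /=.
have -> : freedeg F (s |: U) y = freedeg F U y + (e s y && ((s, y) \notin F)).
  have [h|h] := boolP (e s y && _).
    transitivity #|s |: [set x in U | e x y && ((x, y) \notin F)]|; last first.
      by rewrite cardsU1 inE (negPf sNU) addnC.
    apply: eq_card => x; rewrite !inE.
    by case: eqVneq => //= ->; rewrite h.
  rewrite addn0; apply: eq_card => x; rewrite !inE.
  by case: eqVneq => //= ->; rewrite (negPf h) andbF.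
have [/andP[esy syF]|] := boolP (e s y && _); last by clear; lia.
have [yX|yX] := boolP (y \in X); first by clear; lia.
have [ky|] := ltnP (indeg F y) (kap y); last by clear; lia.
have := blk y esy syF ky; have := nogood y; rewrite /good yX esy syF ky /= => h /(_ h).
by clear; lia.
Qed.

End Step.
End Extendability.

(** * Hall's theorem *)

Section Hall.
Variables (T1 T2 : finType) (r : T1 -> T2 -> bool).
Implicit Types (X S : {set T1}) (Y : {set T2}).

Definition nbhd S Y := [set y in Y | [exists x in S, r x y]].

(** Induction on the size of [X] in the manner of Halmos and Vaughan. The alternative [X = set0]
    covers an empty [T2], for which there may be no function [T1 -> T2] at all. *)
Lemma hall X Y : (forall S, S \subset X -> #|S| <= #|nbhd S Y|) ->
  X = set0 \/ exists g : T1 -> T2,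
  {in X &, injective g} /\ (forall x, x \in X -> (g x \in Y) && r x (g x)).
Proof.
have [k] := ubnP #|X|; elim: k X Y => // k IH X Y cX hX.
have [->|[x0 x0X]] := set_0Vmem X; [by left | right].
have glue S (Z : {set T2}) : S \subset X -> (S = set0 \/ exists g : T1 -> T2,
    {in S &, injective g} /\ (forall x, x \in S -> (g x \in Z) && r x (g x))) ->
  Z \subset Y -> S != set0 ->
  (X :\: S = set0 \/ exists g : T1 -> T2,
    {in X :\: S &, injective g} /\ (forall x, x \in X :\: S -> (g x \in Y :\: Z) && r x (g x))) ->
  exists g : T1 -> T2,
  {in X &, injective g} /\ (forall x, x \in X -> (g x \in Y) && r x (g x)).
  move=> sS [-> _ /eqP//|[g1 [i1 m1]]] sZ S0 h2.
  have [g2 [i2 m2]] : exists g : T1 -> T2,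
    {in X :\: S &, injective g} /\ (forall x, x \in X :\: S -> (g x \in Y :\: Z) && r x (g x)).
    by case: h2 => [->|//]; exists g1; split=> [x y|x]; rewrite inE.
  exists (fun x => if x \in S then g1 x else g2 x); split=> [x y xX yX|x xX].
    case: ifPn => xS; case: ifPn => yS; first exact: i1.
    - move=> E; have /andP[z1 _] := m1 _ xS.
      by have := m2 y; rewrite !inE yS yX -E z1 => /(_ isT).
    - move=> E; have /andP[z1 _] := m1 _ yS.
      by have := m2 x; rewrite !inE xS xX E z1 => /(_ isT).
    - by move=> E; apply: i2 => //; rewrite inE ?xS ?yS.
  case: ifPn => xS; first by have /andP[/(subsetP sZ) -> ->] := m1 _ xS.
  by have := m2 x; rewrite !inE xS xX => /(_ isT) /andP[/andP[_ ->] ->].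
(* A critical proper subset is matched into its neighbourhood, and the rest of [X] into the
   complement of that neighbourhood. *)
have [/existsP[S /and4P[sS S0 SX tS]]|noS] :=
  boolP [exists S : {set T1}, [&& S \subset X, S != set0, S != X & #|nbhd S Y| <= #|S|]].
  have cS : #|S| < #|X| by apply: proper_card; rewrite properEneq SX.
  have sN : nbhd S Y \subset Y by apply/subsetP => y; rewrite inE => /andP[].
  apply: (glue S (nbhd S Y)) => //.
    apply: IH => [|U sU]; first lia.
    apply: leq_trans (hX U (subset_trans sU sS)) _; apply: subset_leq_card.
    apply/subsetP => y; rewrite !inE => /andP[yY /existsP[x /andP[xU rxy]]].
    by rewrite yY /= andbC; apply/andP; split; apply/existsP; exists x; rewrite ?xU ?(subsetP sU).
  apply: IH => [|U sU]; first by have := subset_leq_card sS; rewrite cardsD (setIidPr sS) -card_gt0 in S0 *; lia.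
  have sUX : U :|: S \subset X.
    by rewrite subUset sS andbT; apply: subset_trans sU _; apply: subsetDl.
  have := hX _ sUX; rewrite cardsU.
  have -> : U :&: S = set0.
    apply/eqP; rewrite setI_eq0; apply: disjointWl sU _.
    by rewrite -setI_eq0 setIDAC setDIl setDv setI0.
  rewrite cards0 subn0.
  have -> : nbhd (U :|: S) Y = nbhd U (Y :\: nbhd S Y) :|: nbhd S Y.
    apply/setP => y; rewrite !inE; case: (y \in Y) => //=; rewrite ?andbF //.
    have -> : [exists x in U :|: S, r x y] = [exists x in U, r x y] || [exists x in S, r x y].
      apply/existsP/orP => [[x]|[]/existsP[x /andP[xU rxy]]].
      - by rewrite inE => /andP[/orP[] xU rxy]; [left|right]; apply/existsP; exists x; rewrite xU.
      - by exists x; rewrite inE xU.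
      - by exists x; rewrite inE xU orbT.
    by case: [exists x in U, r x y]; case: [exists x in S, r x y].
  have [+ _] := leq_card_setU (nbhd U (Y :\: nbhd S Y)) (nbhd S Y); lia.
(* Without critical subsets every proper nonempty subset has a surplus of one, so an arbitrary edge
   can be removed first. *)
have : 0 < #|nbhd [set x0] Y| by rewrite -(cards1 x0); apply: hX; rewrite sub1set.
case/card_gt0P => y0; rewrite inE => /andP[y0Y /existsP[x]].
rewrite inE => /andP[/eqP -> rxy].
apply: (glue [set x0] [set y0]) => //.
- by rewrite sub1set.
- by right; exists (fun=> y0); split=> [x1 x2|x1]; rewrite !inE => /eqP -> //; [move/eqP|rewrite eqxx].
- by rewrite sub1set.
- by rewrite -card_gt0 cards1.
have cX' : #|X :\ x0| < #|X| by rewrite [X in _ < X](cardsD1 x0) x0X.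
apply: IH => [|U sU]; first lia.
have sUX : U \subset X by apply: subset_trans sU _; apply: subsetDl.
have [->|U0] := eqVneq U set0; first by rewrite cards0.
have UX : U != X.
  by apply: contraTneq sU => ->; apply/subsetPn; exists x0; rewrite ?inE ?eqxx.
have : #|U| < #|nbhd U Y|.
  by have := hX U sUX; move/existsPn: noS => /(_ U); rewrite sUX U0 UX /=; lia.
have -> : nbhd U (Y :\ y0) = nbhd U Y :\ y0.
  by apply/setP => y; rewrite !inE andbA.
by rewrite (cardsD1 y0 (nbhd U Y)); case: (y0 \in _); lia.
Qed.

End Hall.

(** Hall's theorem after adding [k] dummy partners related to everything; at most [k] vertices
    receive a dummy. [y0] is only a default value for [g]. *)
Lemma hall_deficiency (T1 T2 : finType) (r : T1 -> T2 -> bool) (X : {set T1})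
    (Y : {set T2}) (y0 : T2) (k : nat) :
  (forall S : {set T1}, S \subset X -> #|S| <= #|nbhd r S Y| + k) ->
  exists (X' : {set T1}) (g : T1 -> T2), [/\ X' \subset X, {in X' &, injective g},
    forall x, x \in X' -> (g x \in Y) && r x (g x) & #|X| <= #|X'| + k].
Proof.
move=> hX; pose r' x (y : T2 + 'I_k) := if y is inl z then (z \in Y) && r x z else true.
have [S sS||[g [ig hg]]] := @hall _ _ r' X setT.
- have [->|[x xS]] := set_0Vmem S; first by rewrite cards0.
  apply: leq_trans (hX S sS) _.
  have iE : #|nbhd r S Y| + k = #|inl @: nbhd r S Y :|: [set inr i | i : 'I_k]|.
    rewrite cardsU [X in _ - X]eq_card0 ?subn0.
      by rewrite !card_imset; [rewrite card_ord|move=> a b [] | move=> a b []].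
    by move=> y; rewrite !inE; apply/andP => -[/imsetP[z _ ->] /imsetP[]].
  rewrite iE; apply/subset_leq_card/subsetP => y; rewrite !inE /=.
  case/orP => /imsetP[z zN ->]; last by apply/existsP; exists x; rewrite xS.
  move: zN; rewrite inE => /andP[zY /existsP[x' /andP[x'S rx']]].
  by apply/existsP; exists x'; rewrite x'S /= zY.
- by move=> ->; exists set0, (fun=> y0); split=> // [x|x|]; rewrite ?inE ?cards0.
pose X' := [set x in X | if g x is inl _ then true else false].
exists X', (fun x => if g x is inl y then y else y0); split.
- by apply/subsetP => x; rewrite inE => /andP[].
- move=> x y; rewrite !inE => /andP[xX]; case E: (g x) => [a|//] _ /andP[yX].
  by case E': (g y) => [b|//] _ ab; apply: ig; rewrite ?E ?E' ?ab.
- by move=> x; rewrite inE => /andP[/hg /andP[_]]; case: (g x) => [a|//].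
rewrite -(cardsID X' X) (setIidPr _); last by apply/subsetP => x; rewrite inE => /andP[].
rewrite leq_add2l; have [-> |[x0 x0D]] := set_0Vmem (X :\: X'); first by rewrite cards0.
have [i0 _] : exists i0 : 'I_k, g x0 = inr i0.
  by move: x0D; rewrite !inE => /andP[+ x0X]; rewrite x0X; case: (g x0) => // i; exists i.
rewrite -[X in _ <= X]card_ord.
rewrite -(@card_in_imset _ _ (fun x => if g x is inr i then i else i0)) ?max_card //.
move=> x y; rewrite !inE => /andP[+ xX] /andP[+ yX]; rewrite xX yX.
by case E: (g x) => [//|a]; case E': (g y) => [//|b] _ _ ab; apply: ig; rewrite ?E ?E' ?ab.
Qed.

(** * Edge-disjoint routings *)

Section Routing.
Variables (T : finType) (e : rel T).
Hypotheses (esym : symmetric e) (eirr : irreflexive e).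
Implicit Types (x y : T) (E UE : {set {set T}}) (Dn : {set {set T}}).

(** Connectivity inside an edge set instead of a path: walks can be concatenated freely, and are
    shortened to paths only in [routed_Kimmersion]. *)
Definition linked E x y := connect (fun a b => e a b && ([set a; b] \in E)) x y.

(* [Dn] is a set of two-element vertex sets; the pairs in it are joined inside
   pairwise disjoint sets of edges, all of them subsets of [UE]. *)
Definition routed Dn UE := exists Ep : {set T} -> {set {set T}},
  [/\ forall q, q \in Dn -> Ep q \subset UE,
      forall x y, [set x; y] \in Dn -> linked (Ep [set x; y]) x y &
      forall q q', q \in Dn -> q' \in Dn -> q != q' -> [disjoint Ep q & Ep q']].

Lemma linked_sym E x y : linked E x y = linked E y x.
Proof.
apply: sym_connect_sym => {x y} x y.
by rewrite esym setUC.
Qed.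

Lemma linked1 E x y : e x y -> [set x; y] \in E -> linked E x y.
Proof. by move=> exy xyE; apply: connect1; rewrite exy. Qed.

Lemma linked_trans E x y z : linked E x y -> linked E y z -> linked E x z.
Proof. exact: connect_trans. Qed.

Lemma set2_inj x y x' y' : [set x; y] = [set x'; y'] ->
  (x = x' /\ y = y') \/ (x = y' /\ y = x').
Proof.
move=> E.
have : x \in [set x'; y'] by rewrite -E set21.
have : y \in [set x'; y'] by rewrite -E set22.
have : x' \in [set x; y] by rewrite E set21.
have : y' \in [set x; y] by rewrite E set22.
by rewrite !inE => /orP[]/eqP ? /orP[]/eqP ? /orP[]/eqP ? /orP[]/eqP ?; subst; auto.
Qed.

Lemma routed0 : routed set0 set0.
Proof. by exists (fun=> set0); split=> [q|x y|q q']; rewrite inE. Qed.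

Lemma routed_add_family (I : finType) (J : {set I}) (a b : I -> T)
    (E : I -> {set {set T}}) Dn UE :
  routed Dn UE ->
  (forall i, i \in J -> [set a i; b i] \notin Dn) ->
  (forall i, i \in J -> linked (E i) (a i) (b i)) ->
  (forall i, i \in J -> [disjoint E i & UE]) ->
  {in J &, injective (fun i => [set a i; b i])} ->
  {in J &, forall i j, i != j -> [disjoint E i & E j]} ->
  routed (Dn :|: [set [set a i; b i] | i in J]) (UE :|: \bigcup_(i in J) E i).
Proof.
move=> [Ep [h1 h2 h3]] nD lE dU abI dE.
pose Ep' q := if [pick i in J | [set a i; b i] == q] is Some i then E i else Ep q.
have Ep'D q : q \in Dn -> Ep' q = Ep q.
  rewrite /Ep'; case: pickP => // i /andP[iJ /eqP <-] h.
  by have := nD i iJ; rewrite h.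
have Ep'J i : i \in J -> Ep' [set a i; b i] = E i.
  move=> iJ; rewrite /Ep'; case: pickP => [j /andP[jJ /eqP/abI ->] //|].
  by move=> /(_ i); rewrite iJ eqxx.
have dEq i q : i \in J -> q \in Dn -> [disjoint E i & Ep q].
  by move=> iJ /h1 h; apply: disjointWr (dU i iJ).
exists Ep'; split.
- move=> q; rewrite inE => /orP[qD|/imsetP[i iJ ->]].
    by rewrite Ep'D //; apply: subset_trans (h1 q qD) (subsetUl _ _).
  by rewrite Ep'J //; apply: subset_trans (subsetUr _ _); apply: bigcup_sup.
- move=> x y; rewrite inE => /orP[qD|/imsetP[i iJ qE]].
    by rewrite Ep'D //; apply: h2.
  move: qE => /= qE; case: (set2_inj qE) => -[-> ->].
    by rewrite Ep'J //; apply: lE.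
  by rewrite setUC Ep'J // linked_sym; apply: lE.
- move=> q q'; rewrite !inE => /orP[qD|/imsetP[i iJ ->]] /orP[qD'|/imsetP[j jJ ->]] qq'.
  + by rewrite !Ep'D //; apply: h3.
  + by rewrite (Ep'D _ qD) Ep'J // disjoint_sym; apply: dEq.
  + by rewrite (Ep'D _ qD') Ep'J //; apply: dEq.
  + by rewrite !Ep'J //; apply: dE => //; apply: contraNneq qq' => ->.
Qed.

Lemma routed_add Dn UE E x y : routed Dn UE -> [disjoint E & UE] ->
  linked E x y -> [set x; y] \notin Dn ->
  routed (Dn :|: [set [set x; y]]) (UE :|: E).
Proof.
move=> rD dE lxy nD.
have := @routed_add_family unit setT (fun=> x) (fun=> y) (fun=> E) _ _ rD.
have -> : [set [set x; y] | _ in [set: unit]] = [set [set x; y]].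
  apply/setP => q; rewrite inE; apply/imsetP/eqP => [[_ _ ->] //|->].
  by exists tt; rewrite ?inE.
have -> : \bigcup_(i in [set: unit]) E = E.
  by apply/setP => q; apply/bigcupP/idP => [[_ _] //|qE]; exists tt; rewrite ?inE.
by apply=> // -[] [].
Qed.

End Routing.

Lemma path_edges_sub (n : nat) (e : rel 'I_n) (E : {set {set 'I_n}}) x p :
  path (fun a b : 'I_n => e a b && ([set a; b] \in E)) x p ->
  forall f, f \in path_edges x p -> f \in E.
Proof.
elim: p x => [|y p IH] x //= /andP[/andP[_ xyE] /IH h] f.
by rewrite /path_edges /= inE => /orP[/eqP -> //|]; apply: h.
Qed.

Lemma routed_Kimmersion (n : nat) (e : rel 'I_n) (m : nat) Dn UE : m <= n -> routed e Dn UE ->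
  (forall x y : 'I_n, x < y < m -> [set x; y] \in Dn) ->
  has_Kimmersion e m.
Proof.
move=> mn [Ep [_ h2 h3]] full.
pose phi (u : 'I_m) : 'I_n := widen_ord mn u.
have phi_inj : injective phi by move=> u v /(congr1 val) /= h; apply: val_inj.
have inD (u v : 'I_m) : u < v -> [set phi u; phi v] \in Dn.
  by move=> uv; apply: full; rewrite /= uv ltn_ord.
have /fin_all_exists[P hP] (uv : 'I_m * 'I_m) : exists p : seq 'I_n,
    uv.1 < uv.2 -> is_path e (phi uv.1) (phi uv.2) p /\
      forall f, f \in path_edges (phi uv.1) p -> f \in Ep [set phi uv.1; phi uv.2].
  case: uv => u v /=; have [uv|] := boolP (u < v); last by exists [::].
  have /connectP[p pp lp] := h2 _ _ (inD _ _ uv).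
  case/shortenP: pp lp => q qp uq _ lq.
  exists q => _; split; last exact: path_edges_sub qp.
  split=> //; apply: sub_path qp; by move=> a b /andP[].
exists phi, (fun u v => P (u, v)); split=> //; split=> [u v uv|].
  by have [] := hP (u, v) uv.
move=> u v u' v' uv uv' ne f.
have [_ /= hf] := hP (u, v) uv; have [_ /= hf'] := hP (u', v') uv'.
move=> /hf fE; apply/negP => /hf' fE'.
have dd : [set phi u; phi v] != [set phi u'; phi v'].
  apply: contra ne => /eqP/set2_inj[[/phi_inj -> /phi_inj ->] //|].
  by case=> /phi_inj uE /phi_inj vE; move: uv uv'; rewrite uE vE; lia.
have := disjointFr (h3 _ _ (inD _ _ uv) (inD _ _ uv') dd) fE.
by rewrite fE'.
Qed.

(** * Unrouted pairs: paths of length two, and greedy completion by paths of length three *)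

Section Unrouted.
Variables (T : finType) (e : rel T) (M : {set T}).
Hypotheses (esym : symmetric e) (eirr : irreflexive e).
Local Notation W := (~: M).
Implicit Types (Dn UE : {set {set T}}) (X : {set T}) (g : T -> T).

Definition unrouted Dn x y := [&& x \in M, y \in M, x != y & [set x; y] \notin Dn].
Definition udeg Dn x := #|[set y | unrouted Dn x y]|.
Definition stubs UE x := #|[set w in W | [set x; w] \in UE]|.

Lemma unrouted_sym Dn : symmetric (unrouted Dn).
Proof.
by move=> x y; rewrite /unrouted setUC eq_sym; case: (x \in M); case: (y \in M).
Qed.

(** Since [g] is injective and leaves [X], the pairs [x, g x] form a matching, so a covered vertex
    loses exactly one partner. *)
Lemma udeg_matched Dn X g : {in X &, injective g} ->
  (forall x, x \in X -> (g x \notin X) && unrouted Dn x (g x)) ->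
  forall u, udeg (Dn :|: [set [set x; g x] | x in X]) u + (u \in X :|: g @: X) = udeg Dn u.
Proof.
move=> ig hg u; set Dn' := _ :|: _.
have sub y : unrouted Dn' u y -> unrouted Dn u y.
  by rewrite /unrouted inE negb_or => /and4P[-> -> -> /andP[-> _]].
have lost y : unrouted Dn u y -> ~~ unrouted Dn' u y ->
    (u \in X /\ y = g u) \/ (y \in X /\ u = g y).
  rewrite /unrouted inE => /and4P[-> -> -> nD] /=; rewrite (negPf nD) /= negbK.
  by case/imsetP => x xX /set2_inj[] [-> ->]; [left|right].
have memD' x : x \in X -> [set x; g x] \in Dn'.
  by move=> xX; rewrite inE; apply/orP; right; apply/imsetP; exists x.
case: (boolP (u \in _)) => [ucov|ucov]; last first.
  rewrite addn0; apply: eq_card => y; rewrite !inE.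
  apply/idP/idP => [/sub //|h]; apply: contraT => /(lost y h).
  case=> [[uX _]|[yX uE]]; case/negP: ucov; rewrite inE ?uX //.
  by rewrite uE imset_f ?orbT.
have [v [uv nv lv]] : exists v, [/\ unrouted Dn u v, ~~ unrouted Dn' u v &
    forall y, unrouted Dn u y -> ~~ unrouted Dn' u y -> y = v].
  move: ucov; rewrite inE => /orP[uX|/imsetP[x xX uE]].
    have /andP[gX ug] := hg u uX; exists (g u); split=> //.
      by rewrite /unrouted memD' // !andbF.
    move=> y h /(lost y h)[[_ //]|[yX uE]].
    by have /andP[] := hg y yX; rewrite -uE uX.
  have /andP[gX ug] := hg x xX; exists x; split.
  - by rewrite uE unrouted_sym.
  - by rewrite uE unrouted_sym /unrouted memD' // !andbF.
  move=> y h /(lost y h)[[uX _]|[yX uE']]; first by rewrite -uE uX in gX.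
  by apply: ig => //; rewrite -uE -uE'.
transitivity #|v |: [set y | unrouted Dn' u y]|.
  by rewrite cardsU1 inE nv addnC.
apply: eq_card => y; rewrite !inE; case: eqVneq => [->|yv] /=; first by rewrite uv.
apply/idP/idP => [/sub //|h]; apply: contraT => /(lv y h) yv'.
by rewrite yv' eqxx in yv.
Qed.

Lemma sum_mem (A B : {set T}) : \sum_(u in A) (u \in B) = #|A :&: B|.
Proof.
rewrite -sum1_card [LHS]big_mkcond [RHS]big_mkcond /=.
by apply: eq_bigr => u _; rewrite inE; case: (u \in A); case: (u \in B).
Qed.

Lemma cover_card X g : {in X &, injective g} -> (forall x, x \in X -> g x \notin X) ->
  #|X :|: g @: X| = 2 * #|X|.
Proof.
move=> ig hg; rewrite cardsU [X in _ - X]eq_card0 ?subn0 ?card_in_imset ?mul2n ?addnn //.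
by move=> y; rewrite !inE; apply/negP => /andP[yX /imsetP[x xX yE]]; have := hg x xX; rewrite -yE yX.
Qed.

(* [Wt] is the set of middle vertices used so far. By [pk_stubs] and [pk_miss],
   the number of nonadjacent pairs routed at a vertex of [M] is at least the
   number of its used edges leaving [M], and at most its degree into [Wt]. *)
Record packing Dn UE (Wt : {set T}) : Prop := Packing {
  pk_routed : routed e Dn UE;
  pk_W : Wt \subset W;
  pk_fresh : forall u w, u \in M -> w \in W -> w \notin Wt -> [set u; w] \notin UE;
  pk_WW : forall w w', w \in W -> w' \in W -> [set w; w'] \notin UE;
  pk_stubs : forall u, u \in M -> stubs UE u + udeg Dn u + degin e M u + 1 <= #|M|;
  pk_miss : forall u, u \in M -> #|M| <= udeg Dn u + degin e Wt u + degin e M u + 1 }.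

Lemma packing_init : exists Dn UE, packing Dn UE set0 /\
  forall u, u \in M -> udeg Dn u + degin e M u + 1 = #|M|.
Proof.
pose Dn := [set q | [exists x in M, [exists y in M, e x y && (q == [set x; y])]]].
have DnP x y : ([set x; y] \in Dn) = [&& x \in M, y \in M & e x y].
  rewrite inE; apply/existsP/and3P => [[a /andP[aM]] /existsP[b /and3P[bM eab]]|[xM yM exy]].
    by move=> /eqP/set2_inj[] [-> ->]; rewrite ?aM ?bM ?eab // esym eab.
  by exists x; rewrite xM; apply/existsP; exists y; rewrite yM exy eqxx.
have degE u : u \in M -> udeg Dn u + degin e M u + 1 = #|M|.
  move=> uM; rewrite addn1 [RHS](cardsD1 u) uM add1n; congr _.+1.
  rewrite /udeg /degin -cardsUI [X in _ + X]eq_card0 ?addn0.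
    apply: eq_card => y; rewrite !inE /unrouted DnP uM eq_sym /=.
    case yM: (y \in M); rewrite ?andbF // /= andbT.
    by case: (eqVneq y u) => [->|_] /=; rewrite ?eirr //; case: (e u y).
  by move=> y; rewrite !inE /unrouted DnP uM; case: (y \in M); case: (e u y); rewrite /= ?andbF.
have nM (x y : T) : y \notin M -> [set x; y] \notin Dn.
  by move=> yM; rewrite DnP (negPf yM) andbF.
(* An adjacent pair is, as a two-element set, its own edge, so one set serves as routed pairs and as
   used edges. *)
exists Dn, Dn; split=> //; split.
- exists (fun q => [set q]); split.
  + by move=> q; rewrite sub1set.
  + move=> x y; rewrite DnP => /and3P[_ _ exy]; apply: linked1 => //.
    by rewrite inE.
  + by move=> q q' _ _ qq'; rewrite disjoints1 inE.
- exact: sub0set.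
- by move=> u w _; rewrite inE => wM _; apply: nM.
- by move=> w w' _; rewrite inE; apply: nM.
- move=> u uM; have -> : stubs Dn u = 0.
    apply: eq_card0 => w; rewrite inE; apply/negP => /andP[].
    by rewrite inE => wM; apply/negP; apply: nM.
  by rewrite add0n degE.
- by move=> u uM; have := degE u uM; lia.
Qed.

Lemma stubs_add UE (E : {set {set T}}) u (b : bool) w0 :
  (forall w, w \in W -> [set u; w] \in E -> b /\ w = w0) ->
  stubs (UE :|: E) u <= stubs UE u + b.
Proof.
move=> hE; rewrite /stubs.
apply: (@leq_trans #|[set w in W | [set u; w] \in UE] :|: (if b then [set w0] else set0)|).
  apply: subset_leq_card; apply/subsetP => w; rewrite !inE => /andP[wM /orP[->|wE]].
    by rewrite wM.
  by have [|-> ->] := hE w _ wE; rewrite ?inE ?eqxx ?orbT.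
by apply: leq_trans (leq_card_setU _ _) _; case: (b); rewrite ?cards1 ?cards0.
Qed.

Lemma packing_step Dn UE Wt w X g : packing Dn UE Wt -> w \in W -> w \notin Wt ->
  X \subset [set u in M | e w u] -> {in X &, injective g} ->
  (forall x, x \in X -> (g x \in [set u in M | e w u] :\: X) && unrouted Dn x (g x)) ->
  exists Dn' UE', packing Dn' UE' (w |: Wt) /\
    \sum_(u in M) (udeg Dn' u + degin e (w |: Wt) u) + 2 * #|X|
      = \sum_(u in M) (udeg Dn u + degin e Wt u) + #|[set u in M | e w u]|.
Proof.
move=> [rD sW fresh WW st ms] wW wWt sX ig hg.
have wM : w \notin M by rewrite inE in wW.
set A := [set u in M | e w u] in sX hg *.
have gA x : x \in X -> [/\ g x \in M, e w (g x), g x \notin X & unrouted Dn x (g x)].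
  by move=> /hg; rewrite !inE => /andP[/and3P[-> -> ->] ->].
have XA x : x \in X -> x \in M /\ e w x.
  by move=> /(subsetP sX); rewrite inE => /andP[].
pose E x := [set [set x; w]; [set g x; w]].
have EP f x : f \in E x -> x \in X -> exists2 u, u \in M & f = [set u; w].
  rewrite !inE => /orP[] /eqP -> xX; [exists x|exists (g x)] => //.
    by have [] := XA x xX.
  by have [] := gA x xX.
have swap (u u' z z' : T) : u \in M -> z' \notin M -> [set u; z] = [set u'; z'] -> u = u' /\ z = z'.
  by move=> uM z'M /set2_inj[//|[uE _]]; rewrite uE (negPf z'M) in uM.
have injp : {in X &, injective (fun x => [set x; g x])}.
  move=> x y xX yX /= /set2_inj[[-> //]|[xE _]].
  by have [_ _] := gA y yX; rewrite -xE xX.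
pose Dn' := Dn :|: [set [set x; g x] | x in X].
pose UE' := UE :|: \bigcup_(x in X) E x.
have UE'P u z : z \notin M -> u \in M -> [set u; z] \in \bigcup_(x in X) E x ->
    u \in X :|: g @: X /\ z = w.
  move=> zM uM /bigcupP[x xX]; rewrite !inE => /orP[]/eqP/(swap _ _ _ _ uM wM)[-> ->].
    by rewrite xX.
  by rewrite imset_f ?orbT.
have covE u : udeg Dn' u + (u \in X :|: g @: X) = udeg Dn u.
  by apply: udeg_matched => // x xX; have [_ _ -> ->] := gA x xX.
have covA : X :|: g @: X \subset A.
  rewrite subUset sX; apply/subsetP => y /imsetP[x xX ->].
  by have [gM ewg _ _] := gA x xX; rewrite inE gM.
have degw u : degin e (w |: Wt) u = degin e Wt u + e u w.
  rewrite /degin; case euw: (e u w); last first.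
    rewrite addn0; apply: eq_card => y; rewrite !inE.
    by case: eqVneq => //= ->; rewrite euw andbF.
  transitivity #|w |: [set y in Wt | e u y]|; last by rewrite cardsU1 inE (negPf wWt) addnC.
  by apply: eq_card => y; rewrite !inE; case: eqVneq => //= ->; rewrite euw.
have stE u : u \in M -> stubs UE' u <= stubs UE u + (u \in X :|: g @: X).
  move=> uM; apply: (@stubs_add _ _ _ _ w) => z; rewrite inE => zM.
  exact: UE'P.
exists Dn', UE'; split; first split.
- apply: routed_add_family => //.
  + by move=> x xX; have [_ _ _ /and4P[]] := gA x xX.
  + move=> x xX; have [xM ewx] := XA x xX; have [gM ewg _ _] := gA x xX.
    apply: (@linked_trans _ _ _ _ w); first by apply: linked1; rewrite ?inE ?eqxx // esym.
    by rewrite linked_sym //; apply: linked1; rewrite ?inE ?eqxx ?orbT // esym.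
  + move=> x xX; rewrite disjoint_subset; apply/subsetP => f fE.
    by have [u uM ->] := EP f x fE xX; rewrite inE; apply: fresh.
  + move=> x y xX yX xy; rewrite -setI_eq0; apply/eqP/setP => f; rewrite !inE.
    have [xM _] := XA x xX; have [yM _] := XA y yX.
    have [gxM _ gxX _] := gA x xX; have [gyM _ gyX _] := gA y yX.
    apply/negP => /andP[/orP[]/eqP -> /orP[]/eqP/swap].
    * by move=> /(_ xM wM)[E1 _]; rewrite E1 eqxx in xy.
    * by move=> /(_ xM wM)[E1 _]; rewrite -E1 xX in gyX.
    * by move=> /(_ gxM wM)[E1 _]; rewrite E1 yX in gxX.
    * by move=> /(_ gxM wM)[/ig E1 _]; rewrite E1 ?eqxx in xy.
- by rewrite subUset sub1set wW.
- move=> u z uM zW; rewrite !inE negb_or => /andP[zw zWt].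
  rewrite negb_or fresh //=; apply/negP => /UE'P.
  by rewrite inE in zW; case/(_ zW uM) => _ zE; rewrite zE eqxx in zw.
- move=> z z' zW zW'; rewrite inE negb_or WW //=.
  rewrite !inE in zW zW'; apply/negP => /bigcupP[x xX /EP /(_ xX)[u uM]].
  by case/set2_inj => -[E1 E2]; move: zW zW'; rewrite E1 E2 uM.
- by move=> u uM; have := stE u uM; have := covE u; have := st u uM; case: (u \in _ :|: _); clear; lia.
- move=> u uM; have := covE u; have := ms u uM; rewrite degw.
  have : (u \in X :|: g @: X) <= e u w.
    case h: (u \in _) => //; move/(subsetP covA): h.
    by rewrite inE esym => /andP[_ ->].
  by case: (u \in _); case: (e u w); clear; lia.
have -> : #|A| = \sum_(u in M) e u w.
  rewrite -sum1_card [RHS]big_mkcond [LHS]big_mkcond; apply: eq_bigr => u _.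
  by rewrite inE esym; case: (u \in M); case: (e u w).
have cM : M :&: (X :|: g @: X) = X :|: g @: X.
  by apply/setIidPr; apply: subset_trans covA _; apply/subsetP => u; rewrite inE => /andP[].
have gNX x : x \in X -> g x \notin X by move=> /gA[].
rewrite -(cover_card ig gNX) -cM -sum_mem -!big_split /=.
apply: eq_bigr => u uM; have := covE u; rewrite degw; case: (u \in _ :|: _); case: (e u w); clear; lia.
Qed.



Definition innerW UE := [set f in UE | (f \subset W) && (#|f| == 2)].
Definition freestubs UE u := [set w in W | e u w && ([set u; w] \notin UE)].

Lemma card_freestubs UE u d : #|[set w | e u w]| = d ->
  d <= #|freestubs UE u| + stubs UE u + degin e M u.
Proof.
move=> <-; apply: (@leq_trans #|freestubs UE u :|: [set w in W | [set u; w] \in UE]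
    :|: [set w in M | e u w]|).
  apply/subset_leq_card/subsetP => w; rewrite !inE => ->.
  by case: (w \in M); case: (_ \in UE).
apply: leq_trans (leq_card_setU _ _) _; rewrite leq_add2r.
exact: leq_card_setU.
Qed.

Lemma innerW_dominates UE (A B : {set T}) : A \subset W -> B \subset W ->
  (forall w w', w \in A -> w' \in B -> e w w' -> [set w; w'] \in UE) ->
  \sum_(w in A) degin e B w <= 2 * #|innerW UE|.
Proof.
move=> sA sB hAB.
apply: (@leq_trans (\sum_(w in A) \sum_(f in innerW UE) (w \in f))).
  apply: leq_sum => w wA.
  have -> : \sum_(f in innerW UE) (w \in f) = #|[set f in innerW UE | w \in f]|.
    rewrite -sum1_card [LHS]big_mkcond [RHS]big_mkcond; apply: eq_bigr => f _.
    by rewrite [in RHS]inE; case: (f \in innerW UE); case: (w \in f).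
  rewrite /degin -(@card_in_imset _ _ (fun w' => [set w; w'])).
    apply/subset_leq_card/subsetP => f /imsetP[w']; rewrite inE => /andP[w'B eww] ->.
    rewrite !inE hAB //= cards2 eqxx /= andbT subUset !sub1set.
    rewrite (subsetP sA) // (subsetP sB) //=.
    have -> // : w != w' by apply: contraTneq eww => ->; rewrite eirr.
  move=> x y _ _ /= /set2_inj[[]//|[E1 E2]]; by rewrite E2 -E1.
rewrite exchange_big /= mulnC -sum_nat_const; apply: leq_sum => f.
rewrite inE => /and3P[_ _ /eqP f2]; rewrite -f2.
rewrite -big_mkcondr /= sum1_card; apply: subset_leq_card.
by apply/subsetP => w /andP[].
Qed.

(** The path [u, w, w', v] spends stubs only at [u] and [v], where [udeg] drops at the same time,
    and has a single edge inside [W]. *)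
Lemma greedy_step Dn UE u v w w' : routed e Dn UE -> unrouted Dn u v ->
  w \in freestubs UE u -> w' \in freestubs UE v -> e w w' -> [set w; w'] \notin UE ->
  exists Dn' UE', [/\ routed e Dn' UE',
    forall x, x \in M -> stubs UE' x + udeg Dn' x <= stubs UE x + udeg Dn x,
    \sum_(x in M) udeg Dn' x + 2 = \sum_(x in M) udeg Dn x &
    #|innerW UE'| <= #|innerW UE| + 1].
Proof.
move=> rD uruv; rewrite !inE => /and3P[wM euw uwU] /and3P[w'M evw vwU] eww wwU.
have /and4P[uM vM uv nD] := uruv.
pose E := [set [set u; w]; [set w; w']; [set v; w']].
exists (Dn :|: [set [set u; v]]), (UE :|: E).
have covE x : udeg (Dn :|: [set [set u; v]]) x + (x \in [set u; v]) = udeg Dn x.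
  have := @udeg_matched Dn [set u] (fun=> v).
  rewrite !imset_set1 => -> //.
    by move=> a b; rewrite !inE => /eqP -> /eqP ->.
  by move=> a; rewrite !inE => /eqP ->; rewrite eq_sym uv uruv.
have MW (a b : T) : a \in M -> b \notin M -> a != b.
  by move=> aM; apply: contraNneq => <-.
split.
- apply: routed_add => //.
    rewrite disjoint_subset; apply/subsetP => f.
    by rewrite !inE => /orP[/orP[]|] /eqP ->.
  apply: (@linked_trans _ _ _ _ w); first by apply: linked1; rewrite ?inE ?eqxx.
  apply: (@linked_trans _ _ _ _ w'); first by apply: linked1; rewrite ?inE ?eqxx ?orbT.
  by rewrite linked_sym //; apply: linked1; rewrite ?inE ?eqxx ?orbT.
- move=> x xM; have := covE x.
  have : stubs (UE :|: E) x <= stubs UE x + (x \in [set u; v]).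
    apply: (@stubs_add _ _ _ _ (if x == u then w else w')) => z; rewrite inE => zM.
    rewrite !inE => /orP[/orP[]|] /eqP/set2_inj[][E1 E2].
    + by rewrite E1 eqxx E2.
    + by move: xM; rewrite E1 (negPf wM).
    + by move: xM; rewrite E1 (negPf wM).
    + by move: xM; rewrite E1 (negPf w'M).
    + by rewrite E1 eqxx orbT eq_sym (negPf uv).
    + by move: xM; rewrite E1 (negPf w'M).
  by case: (x \in [set u; v]); clear; lia.
- have -> : 2 = \sum_(x in M) (x \in [set u; v]).
    rewrite sum_mem (setIidPr _) ?cards2 ?uv //.
    by rewrite subUset !sub1set uM.
  by rewrite -big_split; apply: eq_bigr => x _; apply: covE.
rewrite addn1; apply: leq_trans (_ : #|[set w; w'] |: innerW UE| <= _); last first.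
  by rewrite cardsU1; case: (_ \notin _).
apply/subset_leq_card/subsetP => f; rewrite !inE => /and3P[+ fW ->].
case/orP => [->|]; first by rewrite fW orbT.
case/orP => [/orP[]|] /eqP fE; rewrite fE ?eqxx //.
- by move: fW; rewrite fE subUset sub1set inE uM.
- by move: fW; rewrite fE subUset sub1set inE vM.
Qed.

(** Each round adds at most 2 to [2 * #|innerW UE|] and removes 2 from the sum of [udeg], so the
    bound [B] persists. Likewise [stubs + udeg] never grows, which leaves more than [d - #|M|] free
    stubs at every branch vertex. *)
Lemma greedy_finish d (B : nat) :
  (forall u, #|[set w | e u w]| = d) ->
  (forall UE (A A' : {set T}), A \subset W -> A' \subset W ->
     d < #|A| + #|M| -> d < #|A'| + #|M| -> 2 * #|innerW UE| <= B ->
     exists w w', [/\ w \in A, w' \in A', e w w' & [set w; w'] \notin UE]) ->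
  forall Dn UE, routed e Dn UE ->
  (forall u, u \in M -> stubs UE u + udeg Dn u + degin e M u + 1 <= #|M|) ->
  2 * #|innerW UE| + \sum_(x in M) udeg Dn x <= B ->
  exists Dn' UE', routed e Dn' UE' /\
    forall x y, x \in M -> y \in M -> x != y -> [set x; y] \in Dn'.
Proof.
move=> reg hlink Dn UE; move E : (\sum_(x in M) udeg Dn x) => k.
elim/ltn_ind: k Dn UE E => k IH Dn UE E rD st hB.
have [/existsP[u /existsP[v uruv]]|full] := boolP [exists u, [exists v, unrouted Dn u v]].
  have /and4P[uM vM uv nD] := uruv.
  have fr x : x \in M -> d < #|freestubs UE x| + #|M|.
    by move=> xM; have := st x xM; have := card_freestubs UE (reg x); clear; lia.
  have sW x : freestubs UE x \subset W by apply/subsetP => w; rewrite inE => /andP[].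
  have [|w [w' [wA wA' eww wwU]]] := hlink UE _ _ (sW u) (sW v) (fr u uM) (fr v vM).
    by move: hB; clear; lia.
  have [Dn' [UE' [rD' st' su iw]]] := greedy_step rD uruv wA wA' eww wwU.
  apply: (IH (\sum_(x in M) udeg Dn' x) _ Dn' UE') => //.
  - by move: su; rewrite E; clear; lia.
  - by move=> x xM; have := st' x xM; have := st x xM; clear; lia.
  - by move: su iw hB; rewrite E; clear; lia.
exists Dn, UE; split=> // x y xM yM xy.
move/existsPn: full => /(_ x)/existsPn/(_ y).
by rewrite /unrouted xM yM xy /= negbK.
Qed.

End Unrouted.

(** * Sparse case: trees in an extendable arc set *)

Section Arcs.
Variable T : finType.
Implicit Types (x y z : T) (p : seq T) (F G : {set T * T}).

Fixpoint arcs x p : {set T * T} :=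
  if p is y :: p' then (x, y) |: arcs y p' else set0.

Lemma arcs_cons x y p : arcs x (y :: p) = (x, y) |: arcs y p.
Proof. by []. Qed.

Lemma arcs_nil x : arcs x [::] = set0.
Proof. by []. Qed.

Lemma outdegU F G z : outdeg (F :|: G) z <= outdeg F z + outdeg G z.
Proof.
apply: leq_trans (leq_card_setU _ _); apply/subset_leq_card/subsetP => y.
by rewrite !inE.
Qed.

Lemma outdegS F G z : F \subset G -> outdeg F z <= outdeg G z.
Proof.
by move=> /subsetP sF; apply/subset_leq_card/subsetP => y; rewrite !inE; apply: sF.
Qed.

Lemma outdeg1 x y z : outdeg [set (x, y)] z = (z == x).
Proof.
rewrite /outdeg; case: eqVneq => [->|zx]; last first.
  by apply: eq_card0 => w; rewrite !inE xpair_eqE (negPf zx).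
transitivity #|[set y]|; last exact: cards1.
by apply: eq_card => w; rewrite !inE xpair_eqE eqxx.
Qed.

Lemma outdeg0 F z : (forall y, (z, y) \notin F) -> outdeg F z = 0.
Proof. by move=> h; apply: eq_card0 => y; rewrite inE; apply/negbTE. Qed.

Lemma indegU F G z : [disjoint F & G] -> indeg (F :|: G) z = indeg F z + indeg G z.
Proof.
move=> dFG; rewrite /indeg -cardsUI [X in _ + X]eq_card0 ?addn0.
  by apply: eq_card => y; rewrite !inE.
by move=> y; rewrite !inE; apply/negP => /andP[yF]; rewrite (disjointFr dFG yF).
Qed.

Lemma indegS F G z : F \subset G -> indeg F z <= indeg G z.
Proof.
by move=> /subsetP sF; apply/subset_leq_card/subsetP => y; rewrite !inE; apply: sF.
Qed.

Lemma card_arcs x p : #|arcs x p| <= size p.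
Proof.
elim: p x => [|y p IH] x; first by rewrite arcs_nil cards0.
by rewrite arcs_cons cardsU1; apply: (leq_add (leq_b1 _) (IH y)).
Qed.

Lemma arcs_path F x p : path (fun a b => (a, b) \in F) x p -> arcs x p \subset F.
Proof.
elim: p x => [|y p IH] x /=; first by rewrite sub0set.
by case/andP=> xy /IH; rewrite subUset sub1set xy.
Qed.

(** The last vertex of a path has no outgoing arc; the extra term reserves that place for the bridge
    attached there. *)
Lemma outdeg_arcs x p z : uniq (x :: p) ->
  outdeg (arcs x p) z + (z == last x p) <= (z \in x :: p).
Proof.
elim: p x => [|y p IH] x.
  by move=> _; rewrite arcs_nil outdeg0 ?inE // => y; rewrite inE.
rewrite arcs_cons cons_uniq => /andP[xyp uyp]; have := IH y uyp; rewrite (_ : last x (y :: p) = last y p) //.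
have := outdegU [set (x, y)] (arcs y p) z; rewrite outdeg1 [z \in x :: _]inE.
case: eqVneq => [->|_]; first by rewrite (negPf xyp) orTb; move: (outdeg _ x) (outdeg _ x) (x == _) => a b [] /=; clear; lia.
by rewrite orFb; move: (outdeg _ z) (outdeg _ z) (z == _) (z \in _) => a b [] [] /=; clear; lia.
Qed.

Lemma indeg_arcs x p z : (z \in p) <= indeg (arcs x p) z.
Proof.
elim: p x => [|y p IH] x //; rewrite arcs_cons inE.
case: eqVneq => [->|_] /=.
  by apply/card_gt0P; exists x; rewrite !inE eqxx.
by apply: leq_trans (IH y) _; apply: indegS; apply: subsetUr.
Qed.

Lemma sum_outdeg_all F (A : {set T}) : (forall x y, (x, y) \in F -> x \in A) ->
  \sum_(x in A) outdeg F x = #|F|.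
Proof.
move=> FA; rewrite sum_outdeg -sum_indeg; apply: eq_bigr => y _; apply: eq_card => x.
by rewrite !inE; case: (boolP (_ \in F)) => [/FA ->|]; rewrite ?andbF.
Qed.

End Arcs.

Section Growth.
Variables (T : finType) (e : rel T) (kap dem : T -> nat) (Src : {set T}).
Variables (m0 N : nat).
Hypothesis m0_gt0 : 0 < m0.
Hypothesis bigU : forall U : {set T}, U \subset Src -> m0 <= #|U| <= 2 * m0 ->
  \sum_(x in U) dem x + N < room e kap set0 U.
Local Notation ext := (extendable e kap dem Src m0).

(** Take an inclusion-maximal admissible set of arcs. A vertex with fewer than [q] arcs could be
    given another by [extendable_step], unless its demand is already consumed by its arcs and by
    forbidden heads: those in [B], those reached on this level, and those barred by [fb]. *)
Lemma grow_level (F : {set T * T}) (A B : {set T}) (q : nat) (fb : rel T) :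
  ext F -> (forall y, indeg F y <= kap y) -> A \subset Src -> #|F| + q * #|A| <= N ->
  exists Tr : {set T * T},
  [/\ ext (F :|: Tr) /\ (forall y, indeg (F :|: Tr) y <= kap y),
      forall x y, (x, y) \in Tr -> [/\ x \in A, y \notin B, e x y, ~~ fb x y & (x, y) \notin F],
      {in Tr &, injective snd}, forall s, outdeg Tr s <= q &
      forall s, s \in A -> outdeg Tr s = q \/
        dem s <= outdeg (F :|: Tr) s + #|[set y in B :|: [set a.2 | a in Tr] :|: [set y | fb s y]
           | e s y && ((s, y) \notin F :|: Tr)]| ].
Proof.
move=> extF indF AS FN.
pose ok (Tr : {set T * T}) := [&& ext (F :|: Tr), [forall y, indeg (F :|: Tr) y <= kap y],
  [forall a in Tr, [&& a.1 \in A, a.2 \notin B, e a.1 a.2, ~~ fb a.1 a.2 & a \notin F]],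
  [forall a in Tr, [forall b in Tr, (a.2 == b.2) ==> (a == b)]] &
  [forall s, outdeg Tr s <= q]].
have ok0 : ok set0.
  rewrite /ok setU0 extF; apply/and5P; split=> //.
  - exact/forallP.
  - by apply/forallP => a; rewrite inE.
  - by apply/forallP => a; rewrite inE.
  - by apply/forallP => s; rewrite outdeg0 // => y; rewrite inE.
have [Tr /maxsetP[/and5P[extT /forallP indT /forallP arcT /forallP injT /forallP outT] maxT]] :=
  ex_maxset (ex_intro ok set0 ok0).
have {}arcT x y : (x, y) \in Tr -> [/\ x \in A, y \notin B, e x y, ~~ fb x y & (x, y) \notin F].
  by move=> xyT; have := arcT (x, y); rewrite xyT => /and5P[].
have {}injT : {in Tr &, injective snd}.
  move=> a b aT bT ab; have := injT a; rewrite aT => /forallP/(_ b).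
  by rewrite bT ab eqxx => /eqP.
exists Tr; split=> // s sA.
have [|qs] := leqP q (outdeg Tr s); first by have := outT s; left; apply/eqP; rewrite eqn_leq outT.
right; rewrite leqNgt; apply/negP => dem_s.
have cT : #|F :|: Tr| <= N.
  apply: leq_trans (leq_card_setU _ _) _; apply: leq_trans FN; rewrite leq_add2l.
  rewrite -(@sum_outdeg_all _ Tr A); last by move=> x y /arcT[].
  by rewrite mulnC -sum_nat_const; apply: leq_sum.
have [y [yX esy syF ky exty]] :=
  extendable_step m0_gt0 bigU extT cT (subsetP AS s sA) dem_s.
move: yX syF; rewrite !inE !negb_or => /andP[/andP[yB yT] nfb] /andP[syF syT].
have heads a : a \in Tr -> a.2 != y.
  by move=> aT; apply: contraNneq yT => <-; apply: imset_f.
suff /maxT : ok ((s, y) |: Tr).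
  by rewrite subsetUr => /(_ isT) E; rewrite -E !inE eqxx in syT.
have FE : F :|: ((s, y) |: Tr) = (s, y) |: (F :|: Tr) by rewrite setUCA.
rewrite /ok FE exty; apply/and5P; split=> //.
- apply/forallP => z; have [->|zy] := eqVneq z y.
    apply: leq_trans ky; rewrite /indeg; apply: leq_trans (_ : #|s |: [set x | (x, y) \in F :|: Tr]| <= _).
      by apply/subset_leq_card/subsetP => x; rewrite !inE xpair_eqE eqxx andbT.
    by rewrite cardsU1; apply: (leq_add (leq_b1 _) (leqnn _)).
  apply: leq_trans (indT z); apply/subset_leq_card/subsetP => x.
  by rewrite !inE xpair_eqE (negPf zy) andbF.
- apply/forallP => -[x z]; apply/implyP; rewrite !inE => /orP[/eqP[-> ->]|/arcT[-> -> -> -> ->] //].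
  by rewrite sA yB esy nfb syF.
- apply/forallP => a; apply/implyP => aT'; apply/forallP => b; apply/implyP => bT'; apply/implyP.
  move: aT' bT'; rewrite !in_setU1 => /orP[/eqP ->|aT] /orP[/eqP ->|bT] //=.
  + by move/eqP => E; have := heads b bT; rewrite -E eqxx.
  + by move/eqP => E; have := heads a aT; rewrite E eqxx.
  + by move/eqP/(injT _ _ aT bT) ->.
- apply/forallP => z; apply: leq_trans (outdegU _ _ _) _; rewrite outdeg1.
  by case: eqVneq => [->|_] //; rewrite add0n.
Qed.

End Growth.

(** * Routing one pair at a time through two trees and a bridge *)

Section Sparse.
Variables (T : finType) (e : rel T) (M Dead : {set T}) (k Q0 H m0 N : nat).
Hypotheses (esym : symmetric e) (eirr : irreflexive e).
Hypothesis MDead : [disjoint M & Dead].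
Implicit Types (F Ec Tr : {set T * T}) (A B : {set T}).
Implicit Types (Dn UE : {set {set T}}).

Local Notation n := #|T|.
Local Notation Z := (M :|: Dead).
Definition cap (y : T) := if y \in Z then 0 else k.
(** A branch vertex has fewer than [#|M| - degin e M x] half-paths to start, so a surplus of [Q0]
    arcs is available for rooting a tree at any time. *)
Definition demand (x : T) := if x \in M then #|M| - degin e M x + Q0 else 6 * k.
Local Notation ext := (extendable e cap demand (~: Dead) m0).
(** A pair costs at most [2 * (H + 1)] arcs in its half-paths and two for its bridge. The sum of
    [udeg] over [M] counts each pair twice, hence [H + 2] per unit. *)
Definition budget := (H + 2) * (#|M| * #|M|).

Hypothesis m0_gt0 : 0 < m0.
Hypothesis ext0 : ext set0.
Hypothesis bigU : forall U : {set T}, U \subset ~: Dead -> m0 <= #|U| <= 2 * m0 ->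
  \sum_(x in U) demand x + N < room e cap set0 U.
Hypotheses (k_ge8 : 8 <= k) (Q0_gt0 : 0 < Q0) (H_large : n < 2 ^ H * Q0).
Hypothesis N_large : budget + 6 * n <= N.
Hypothesis Q0n : Q0 <= n.
Hypothesis spread : forall A2 B, 40 * #|B| <= n ->
  (forall s, s \in A2 -> 3 * k <= degin e B s) -> 13 * #|A2| <= #|B|.
Hypothesis joined : forall A B, n < 240 * #|A| -> n < 240 * #|B| ->
  2 * budget < \sum_(x in A) degin e B x.

(* [F] consists of the arcs of the two half-paths of every routed pair, oriented
   away from the endpoints in [M]; [Ec] holds both orientations of the bridges
   joining the half-paths. By [st_outW], leaving a vertex outside [M] costs an
   arc entering it, so [cap] also bounds the used out-degrees. *)
Record state Dn UE F Ec : Prop := State {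
  st_routed : routed e Dn UE;
  st_UE : forall x y, [set x; y] \in UE -> (x \in M) && (y \in M) \/
     [|| (x, y) \in F, (y, x) \in F | (x, y) \in Ec];
  st_e : forall x y, (x, y) \in F -> e x y;
  st_ind : forall y, indeg F y <= cap y;
  st_ext : ext F;
  st_outM : forall u, u \in M -> outdeg F u + udeg M Dn u + degin e M u + 1 <= #|M|;
  st_outW : forall z, z \notin Z -> outdeg F z + outdeg Ec z <= indeg F z;
  st_EcZ : forall x y, (x, y) \in Ec -> x \notin Z;
  st_card : #|F| + #|Ec| + (H + 2) * \sum_(x in M) udeg M Dn x <= budget }.

Definition taken F Ec : rel T :=
  fun x y => [|| (x, y) \in F, (y, x) \in F | (x, y) \in Ec].

Section Tree.
Variables (F Ec F1 : {set T * T}) (r : T).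
Hypotheses (rM : r \in M) (sF : F \subset F1).
Hypotheses (extF1 : ext F1) (indF1 : forall y, indeg F1 y <= cap y).
Hypotheses (F1N : #|F1| <= budget + n) (outr : outdeg F1 r = outdeg F r).
Hypotheses (outF1 : forall z, z \notin Z -> outdeg F1 z <= outdeg F z + 4).
Hypothesis EcZ : forall x y, (x, y) \in Ec -> x \notin Z.
Hypothesis outW : forall z, z \notin Z -> outdeg F z + outdeg Ec z <= indeg F z.
Hypothesis outM : outdeg F r + degin e M r + 1 <= #|M|.

(* Arcs are added level by level from [r]: [A] is the last level and [B] the set
   of all vertices reached. [F1] may contain a tree grown before this one. *)
Record tree Tr A B i : Prop := Tree {
  tr_ext : ext (F1 :|: Tr);
  tr_ind : forall y, indeg (F1 :|: Tr) y <= cap y;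
  tr_arc : forall x y, (x, y) \in Tr -> [/\ e x y, ~~ taken F Ec x y, (x, y) \notin F1,
     (x \in B) && (x \notin A) & (x == r) || (x \notin Z)];
  tr_AB : A \subset B;
  tr_AZ : forall x, x \in A -> x \notin Z;
  tr_TB : #|Tr| <= #|B|;
  tr_BA : #|B| <= 2 * #|A|;
  tr_out : forall z, z != r -> outdeg Tr z <= 4;
  tr_path : forall y, y \in A -> exists p, [/\ path (fun a b => (a, b) \in Tr) r p,
     last r p = y & size p <= i.+1] }.

Lemma head_notZ G y x : (forall y, indeg G y <= cap y) -> (x, y) \in G -> y \notin Z.
Proof.
move=> indG xyG; apply/negP => yZ; have := indG y; rewrite /cap yZ leqn0.
by rewrite cards_eq0 => /eqP/setP/(_ x); rewrite !inE xyG.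
Qed.

Lemma rZ : r \in Z. Proof. by rewrite inE rM. Qed.

(** The heads forbidden at the root are all reached by arcs already counted in its out-degree, so by
    [outM] the surplus [Q0] in its demand is really available. *)
Lemma tree_root : exists Tr A B, tree Tr A B 0 /\ Q0 <= #|A|.
Proof.
have rS : [set r] \subset ~: Dead.
  by rewrite sub1set inE (disjointFr MDead rM).
have cN : #|F1| + Q0 * #|[set r]| <= N.
  by rewrite cards1 muln1; move: F1N Q0n N_large; clear; lia.
have [Tr [[extT indT] arcT injT outT stuck]] :=
  grow_level m0_gt0 bigU [set r] (taken F Ec) extF1 indF1 rS cN.
have hd x y : (x, y) \in Tr -> y \notin Z.
  by move=> xyT; apply: (head_notZ indT (x := x)); rewrite inE xyT orbT.
have tl x y : (x, y) \in Tr -> x = r by case/arcT => /set1P.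
have outQ : outdeg Tr r = Q0.
  have [//|] := stuck r (set11 r).
  rewrite [X in _ + X](_ : _ = 0); last first.
    apply: eq_card0 => y; rewrite [LHS]inE; apply/negP => /andP[].
    rewrite !inE => yX /andP[ery]; rewrite negb_or => /andP[nF1 nT].
    case/orP: yX => [/orP[/eqP E|/imsetP[[a b] abT E]]|].
    - by rewrite E eirr in ery.
    - by move: E nT abT => /= ->; move=> nT abT; rewrite -(tl _ _ abT) abT in nT.
    case/or3P => [rF|yF|/EcZ]; last by rewrite rZ.
      by rewrite (subsetP sF) in nF1.
    by have := head_notZ indF1 (subsetP sF _ yF); rewrite rZ.
  have := outdegU F1 Tr r; rewrite /demand rM outr.
  by have := outT r; move: outM Q0_gt0; clear; lia.
have cT : #|Tr| = Q0.
  by rewrite -outQ -(@sum_outdeg_all _ Tr [set r]) ?big_set1 // => x y /arcT[].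
have cA : #|[set a.2 | a in Tr]| = Q0 by rewrite card_in_imset.
exists Tr, [set a.2 | a in Tr], (r |: [set a.2 | a in Tr]); split; last by rewrite cA.
split=> //.
- move=> x y xyT; have [_ yr exy nfb nF1] := arcT x y xyT.
  rewrite (tl _ _ xyT) in exy nfb nF1 *; split; rewrite ?eqxx //.
  rewrite !inE eqxx /=; apply/negP => /imsetP[[a b] abT E].
  by have := hd _ _ abT; rewrite -[b]/((a, b).2) -E rZ.
- exact: subsetUr.
- by move=> x /imsetP[[a b] abT ->]; apply: hd abT.
- by rewrite cT cardsU1 cA leq_addl.
- by rewrite cardsU1 cA mul2n -addnn leq_add2r; apply: leq_trans (leq_b1 _) Q0_gt0.
- by move=> z zr; rewrite outdeg0 // => y; apply: contra zr => /tl ->.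
- move=> y /imsetP[[a b] abT ->]; exists [:: b]; split=> //=.
  by rewrite -(tl _ _ abT) abT.
Qed.

Lemma tree_level Tr A B i : tree Tr A B i -> 240 * #|A| <= n ->
  exists Tr' A' B', tree Tr' A' B' i.+1 /\ 2 * #|A| <= #|A'|.
Proof.
move=> t An.
have AS : A \subset ~: Dead.
  by apply/subsetP => x /(tr_AZ t); rewrite !inE negb_or => /andP[].
have Bn : #|B| <= n by exact: max_card.
have An' : #|A| <= n by exact: max_card.
(* The earlier tree, the present one and the new level have at most [n], [n] and [4 * n] arcs,
   whence [6 * n] in [N_large]. *)
have cN : #|F1 :|: Tr| + 4 * #|A| <= N.
  have [+ _] := leq_card_setU F1 Tr; have := tr_TB t.
  by move: F1N N_large Bn An'; clear; lia.
have [Tr2 [[extT indT] arcT injT outT stuck]] :=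
  grow_level m0_gt0 bigU B (taken F Ec) (tr_ext t) (tr_ind t) AS cN.
set A' := [set a.2 | a in Tr2] in stuck *.
have cA' : #|A'| = #|Tr2| by rewrite /A' card_in_imset.
have hd x y : (x, y) \in Tr2 -> y \notin Z.
  by move=> xyT; apply: (head_notZ indT (x := x)); rewrite inE xyT orbT.
have A'B : [disjoint A' & B].
  rewrite disjoint_subset; apply/subsetP => y /imsetP[[a b] /arcT[_ bB _ _ _] ->].
  by rewrite inE.
have sumT : \sum_(s in A) outdeg Tr2 s = #|Tr2|.
  by apply: sum_outdeg_all => x y /arcT[].
have T2le : #|Tr2| <= 4 * #|A|.
  by rewrite -sumT mulnC -sum_nat_const; apply: leq_sum.
have cB' : #|B :|: A'| = #|B| + #|A'|.
  rewrite cardsU [X in _ - X]eq_card0 ?subn0 // => y; rewrite inE.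
  by apply/negP => /andP[yB yA']; rewrite (disjointFr A'B yA') in yB.
pose A2 := [set s in A | outdeg Tr2 s != 4].
have A2deg s : s \in A2 -> 3 * k <= degin e (B :|: A') s.
  rewrite inE => /andP[sA s4]; case: (stuck s sA) => [E|]; first by rewrite E in s4.
  have sZ := tr_AZ t sA.
  have sM : s \notin M by apply: contra sZ; rewrite inE => ->.
  rewrite /demand (negPf sM).
  have sT0 : outdeg Tr s = 0.
    by apply: outdeg0 => y; apply/negP => /(tr_arc t)[_ _ _]; rewrite sA andbF.
  have h1 := outdegU (F1 :|: Tr) Tr2 s; have h2 := outdegU F1 Tr s.
  have h3 := outF1 sZ; have h4 := outW sZ; have h5 := outT s.
  have h6 : indeg F s <= k.
    by apply: leq_trans (indegS s sF) _; have := indF1 s; rewrite /cap (negPf sZ).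
  (* At [s] the arcs of [F] and [Ec] account for at most [2 * k] of the demand and the two trees for
     at most 8. Of [6 * k] at least [4 * k - 8 >= 3 * k] remain, to be explained by neighbours in
     the tree. *)
  suff : #|[set y in B :|: A' :|: [set y | taken F Ec s y]
      | e s y && ((s, y) \notin F1 :|: Tr :|: Tr2)]|
      <= degin e (B :|: A') s + (indeg F s + outdeg Ec s).
    by move: h1 h2 h3 h4 h5 h6 sT0 k_ge8; clear; lia.
  apply: leq_trans (_ : #|[set y in B :|: A' | e s y] :|:
     ([set y | (y, s) \in F] :|: [set y | (s, y) \in Ec])| <= _).
    apply/subset_leq_card/subsetP => y; rewrite [y \in [set _ in _ | _]]inE !in_setU.
    rewrite ![y \in [set _ | _]]inE negb_or => /andP[yX /andP[esy /andP[]]].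
    rewrite negb_or => /andP[nF1 _] _; rewrite esy.
    case/orP: yX => [->//|/or3P[sF'|->|->]]; rewrite ?orbT //.
    by rewrite (subsetP sF) in nF1.
  apply: leq_trans (leq_card_setU _ _) _; rewrite leq_add2l.
  exact: leq_card_setU.
(* The enlarged tree has at most [2 * #|A| + 4 * #|A|] vertices, so the threshold 240 is 6 times the
   40 of [spread]. *)
have cA2 : 13 * #|A2| <= #|B :|: A'|.
  apply: spread => //; rewrite cB' cA'; have := tr_BA t; move: An T2le; clear; lia.
have T2ge : 4 * (#|A| - #|A2|) <= #|Tr2|.
  have A2A : A2 \subset A by apply/subsetP => s; rewrite inE => /andP[].
  rewrite -(setIidPr A2A) -cardsD -sumT (big_setID A2) /= mulnC -sum_nat_const.
  apply: leq_trans (leq_addl _ _); apply: leq_sum => s.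
  by rewrite !inE => /andP[+ sA]; rewrite sA negbK => /eqP ->.
(* At most 6/13 of [A] is stuck, and the others have four children each: 28/13 > 2. *)
have A'ge : 2 * #|A| <= #|A'|.
  by rewrite cA'; move: T2ge cA2 T2le (tr_BA t); rewrite cB' cA'; clear; lia.
exists (Tr :|: Tr2), A', (B :|: A'); split=> //; split; rewrite ?setUA //.
- move=> x y; rewrite inE => /orP[xyT|xyT].
    have [exy nfb nF1 /andP[xB xA] xr] := tr_arc t xyT; split=> //.
    by rewrite inE xB /= (disjointFl A'B xB).
  have [xA yB exy nfb] := arcT _ _ xyT; rewrite inE negb_or => /andP[nF1 _].
  have xB := subsetP (tr_AB t) x xA; split=> //.
    by rewrite inE xB /= (disjointFl A'B xB).
  by rewrite (tr_AZ t xA) orbT.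
- exact: subsetUr.
- by move=> x /imsetP[[a b] abT ->]; apply: hd abT.
- rewrite cB' cA'; apply: leq_trans (leq_card_setU _ _) _.
  by rewrite leq_add2r (tr_TB t).
- by rewrite cB'; move: A'ge (tr_BA t); clear; lia.
- move=> z zr; apply: leq_trans (outdegU _ _ _) _.
  have [zA|zA] := boolP (z \in A).
    rewrite outdeg0 => [|y]; first by rewrite add0n; apply: outT.
    by apply/negP => /(tr_arc t)[_ _ _]; rewrite zA andbF.
  rewrite [X in _ + X]outdeg0 => [|y]; first by rewrite addn0; apply: tr_out t _ zr.
  by apply: contra zA => /arcT[].
- move=> y /imsetP[[a b] abT ->] /=; have [aA _ _ _ _] := arcT _ _ abT.
  have [p [pp lp sp]] := tr_path t aA.
  exists (rcons p b); rewrite rcons_path last_rcons size_rcons lp; split=> //.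
  rewrite !inE abT orbT andbT; apply: sub_path pp => x z; by rewrite inE => ->.
Qed.

(** Levels at least double from size [Q0], and [2 ^ H * Q0] exceeds the number of vertices, so the
    threshold is reached within [H] levels. From then on the tree is kept and only the bound on path
    lengths is relaxed. *)
Lemma tree_large : exists Tr A B, tree Tr A B H /\ n < 240 * #|A|.
Proof.
have [Tr [A [B [t big]]]] : exists Tr A B, tree Tr A B H /\
    (n < 240 * #|A| \/ 2 ^ H * Q0 <= #|A|).
  elim: H => [|i [Tr [A [B [t hA]]]]].
    have [Tr [A [B [t hA]]]] := tree_root.
    by exists Tr, A, B; split=> //; right; rewrite mul1n.
  have [An|An] := ltnP n (240 * #|A|).
    exists Tr, A, B; split; last by left.
    case: t => t1 t2 t3 t4 t5 t6 t7 t8 tp; split=> // y yA.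
    have [p [pp lp sp]] := tp y yA.
    by exists p; split=> //; apply: leqW.
  case: hA => [hA|hA]; first by rewrite ltnNge An in hA.
  have [Tr' [A' [B' [t' hA']]]] := tree_level t An.
  exists Tr', A', B'; split=> //; right; rewrite expnS -mulnA.
  by apply: leq_trans hA'; rewrite leq_mul2l hA orbT.
exists Tr, A, B; split=> //; case: big => // h.
have : #|A| <= n by exact: max_card.
by move: H_large h; clear; lia.
Qed.

End Tree.

Lemma linked_arcs (E : {set {set T}}) x p :
  (forall a b, (a, b) \in arcs x p -> e a b /\ [set a; b] \in E) ->
  linked e E x (last x p).
Proof.
elim: p x => [|y p IH] x; first by move=> _; apply: connect0.
rewrite arcs_cons => h; apply: (@linked_trans _ _ _ _ y).
  by have [exy xyE] := h x y (setU11 _ _); apply: linked1.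
by apply: IH => a b abp; apply: h; rewrite setU1r.
Qed.

Lemma short_path (G : {set T * T}) x y p :
  path (fun a b => (a, b) \in G) x p -> last x p = y ->
  exists q, [/\ arcs x q \subset G, uniq (x :: q), last x q = y & size q <= size p].
Proof.
move=> pp lp; case/shortenP: pp lp => q qp uq sq lq; exists q; split=> //.
  exact: arcs_path.
by apply: uniq_leq_size => //; case/andP: uq.
Qed.

(** An arc of [F] blocks at most two ordered pairs and an arc of [Ec] one; [joined] supplies more
    adjacent ordered pairs than that. *)
Lemma free_bridge F Ec A A' : 2 * (#|F| + #|Ec|) <= 2 * budget ->
  n < 240 * #|A| -> n < 240 * #|A'| ->
  exists x y, [/\ x \in A, y \in A', e x y & ~~ taken F Ec x y].
Proof.
move=> FB cA cA'; pose P x y := [&& x \in A, y \in A', e x y & ~~ taken F Ec x y].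
have [/existsP[x /existsP[y /and4P[]]]|none] := boolP [exists x, [exists y, P x y]].
  by exists x, y.
have := joined cA cA'; rewrite ltnNge => /negP[]; apply: leq_trans FB.
apply: (@leq_trans (\sum_x (outdeg F x + (indeg F x + outdeg Ec x)))).
  rewrite [X in _ <= X](bigID (mem A)) /=; apply: leq_trans (leq_addr _ _).
  apply: leq_sum => x xA; apply: (@leq_trans #|[set y | (x, y) \in F] :|:
      ([set y | (y, x) \in F] :|: [set y | (x, y) \in Ec])|).
    apply/subset_leq_card/subsetP => y; rewrite inE => /andP[yA' exy].
    move/existsPn: none => /(_ x)/existsPn/(_ y); rewrite /P xA yA' exy /= negbK.
    by case/or3P; rewrite !inE => ->; rewrite ?orbT.
  apply: leq_trans (leq_card_setU _ _) _; rewrite leq_add2l.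
  exact: leq_card_setU.
have sumT G : \sum_x outdeg G x = #|G|.
  rewrite -(@sum_outdeg_all _ G setT) => [|x y _]; last by rewrite inE.
  by apply: eq_bigl => x; rewrite inE.
rewrite !big_split /= !sumT sum_indeg mul2n -addnn.
by apply: leq_add => //; apply: leq_addr.
Qed.

(** Both trees avoid the edges of earlier pairs but may share edges with each other. This is
    harmless: all edges kept serve the single pair [u, v], for which connectivity suffices. *)
Lemma state_step Dn UE F Ec u v : state Dn UE F Ec -> unrouted M Dn u v ->
  exists Dn' UE' F' Ec', state Dn' UE' F' Ec' /\
    \sum_(x in M) udeg M Dn' x + 2 = \sum_(x in M) udeg M Dn x.
Proof.
move=> st uruv; have /and4P[uM vM uv nD] := uruv.
have FB : #|F| + #|Ec| <= budget by move: (st_card st); clear; lia.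
have outM w : w \in M -> outdeg F w + degin e M w + 1 <= #|M|.
  by move=> wM; move: (st_outM st wM); clear; lia.
have MZ w : w \in M -> w \in Z by rewrite inE => ->.
have [Tr [A [B [t cA]]]] : exists Tr A B, tree F Ec F u Tr A B H /\ n < 240 * #|A|.
  apply: tree_large => //; first exact: st_ext st.
  - exact: st_ind st.
  - by move: FB; clear; lia.
  - by move=> z _; rewrite leq_addr.
  - exact: st_EcZ st.
  - exact: st_outW st.
  - exact: outM.
have TrZ a b : (a, b) \in Tr -> b \notin Z.
  by move=> abT; apply: (head_notZ (tr_ind t) (x := a)); rewrite inE abT orbT.
have Trtail w b : w \in M -> w != u -> (w, b) \notin Tr.
  move=> wM wu; apply/negP => /(tr_arc t)[_ _ _ /andP[_]].
  by rewrite (negPf wu) /= MZ.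
have [Tr' [A' [B' [t' cA']]]] : exists Tr' A' B',
    tree F Ec (F :|: Tr) v Tr' A' B' H /\ n < 240 * #|A'|.
  apply: tree_large => //; first exact: subsetUl.
  - exact: tr_ext t.
  - exact: tr_ind t.
  - apply: leq_trans (leq_card_setU _ _) _; apply: leq_add; first by move: FB; clear; lia.
    by apply: leq_trans (tr_TB t) _; apply: max_card.
  - apply/eqP; rewrite eqn_leq (outdegS _ (subsetUl _ _)) andbT.
    apply: leq_trans (outdegU _ _ _) _; rewrite [X in _ + X]outdeg0 ?addn0 // => y.
    by apply: Trtail => //; rewrite eq_sym.
  - move=> z zZ; apply: leq_trans (outdegU _ _ _) _; rewrite leq_add2l.
    by apply: (tr_out t); apply: contraNneq zZ => ->; apply: MZ.
  - exact: st_EcZ st.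
  - exact: st_outW st.
  - exact: outM.
have TrZ' a b : (a, b) \in Tr' -> b \notin Z.
  by move=> abT; apply: (head_notZ (tr_ind t') (x := a)); rewrite inE abT orbT.
have Trtail' w b : w \in M -> w != v -> (w, b) \notin Tr'.
  move=> wM wv; apply/negP => /(tr_arc t')[_ _ _ /andP[_]].
  by rewrite (negPf wv) /= MZ.
have [x [y [xA yA exy nxy]]] : exists x y, [/\ x \in A, y \in A', e x y & ~~ taken F Ec x y].
  by apply: free_bridge => //; rewrite leq_mul2l.
have [p0 [pp0 lp0 sp0]] := tr_path t xA; have [p [sP up lp sp]] := short_path pp0 lp0.
have [q0 [qq0 lq0 sq0]] := tr_path t' yA; have [q [sQ uq lq sq]] := short_path qq0 lq0.
set P := arcs u p in sP *; set Q := arcs v q in sQ *.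
have xZ := tr_AZ t xA; have yZ := tr_AZ t' yA.
have PTr a b : (a, b) \in P -> [/\ e a b, ~~ taken F Ec a b, b \notin Z & (a, b) \notin F].
  by move/(subsetP sP) => abT; have [eab ntk nF _] := tr_arc t abT; split=> //; apply: TrZ abT.
have QTr a b : (a, b) \in Q -> [/\ e a b, ~~ taken F Ec a b, b \notin Z & (a, b) \notin F :|: Tr].
  by move/(subsetP sQ) => abT; have [eab ntk nF _] := tr_arc t' abT; split=> //; apply: TrZ' abT.
pose E := [set [set a.1; a.2] | a in (x, y) |: (P :|: Q)].
have EP a b : (a, b) \in (x, y) |: (P :|: Q) -> [/\ e a b, ~~ taken F Ec a b & b \notin Z].
  by rewrite in_setU1 [_ \in P :|: Q]in_setU => /or3P[/eqP[-> ->]|/PTr[]|/QTr[]].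
pose Ec' := [set (x, y)] :|: [set (y, x)] :|: Ec.
pose F' := F :|: P :|: Q.
have sF' : F' \subset F :|: Tr :|: Tr' by rewrite setUSS // setUS.
have covE w : udeg M (Dn :|: [set [set u; v]]) w + (w \in [set u; v]) = udeg M Dn w.
  have := @udeg_matched _ M Dn [set u] (fun=> v).
  rewrite !imset_set1 => -> //.
    by move=> a b; rewrite !inE => /eqP -> /eqP ->.
  by move=> a; rewrite !inE => /eqP ->; rewrite eq_sym uv uruv.
have sumD : \sum_(w in M) udeg M (Dn :|: [set [set u; v]]) w + 2 = \sum_(w in M) udeg M Dn w.
  have -> : 2 = \sum_(w in M) (w \in [set u; v]).
    rewrite sum_mem (setIidPr _) ?cards2 ?uv //.
    by rewrite subUset !sub1set uM.
  by rewrite -big_split; apply: eq_bigr => w _; apply: covE.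
exists (Dn :|: [set [set u; v]]), (UE :|: E), F', Ec'; split=> //; split.
- apply: routed_add => //; first exact: st_routed st.
    rewrite disjoint_subset; apply/subsetP => f /imsetP[[a b] abE ->]; rewrite inE.
    have [_ ntk bZ] := EP _ _ abE; apply/negP => /(st_UE st)[/andP[_ /MZ]|h].
      by rewrite (negPf bZ).
    by move/negP: ntk; apply.
  have lP : linked e E u x.
    rewrite -lp; apply: linked_arcs => a b abP; have [eab _ _ _] := PTr _ _ abP; split=> //.
    by apply/imsetP; exists (a, b); rewrite // !inE abP orbT.
  have lQ : linked e E v y.
    rewrite -lq; apply: linked_arcs => a b abQ; have [eab _ _ _] := QTr _ _ abQ; split=> //.
    by apply/imsetP; exists (a, b); rewrite // !inE abQ !orbT.
  apply: (linked_trans lP); apply: (@linked_trans _ _ _ _ y); last by rewrite linked_sym.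
  by apply: linked1 => //; apply/imsetP; exists (x, y); rewrite // !inE eqxx.
- move=> a b; rewrite inE => /orP[/(st_UE st)[->|h]|/imsetP[[c c'] cE /set2_inj h]]; first by left.
    by right; case/or3P: h => h; rewrite !inE h ?orbT.
  right; move: cE; rewrite !inE !xpair_eqE.
  by case: h => -[-> ->] /=; case/or3P => [/andP[/eqP -> /eqP ->]|h|h]; rewrite ?eqxx ?h ?orbT.
- by move=> a b; rewrite !inE => /orP[/orP[/(st_e st)|/PTr[]]|/QTr[]].
- by move=> z; apply: leq_trans (tr_ind t' z); apply: indegS.
- apply: extendable_sub sF' _ (tr_ind t') (tr_ext t') => a b.
  by rewrite !inE => /orP[/orP[/(st_e st)|/(tr_arc t)[]]|/(tr_arc t')[]].
- move=> w wM; have := st_outM st wM; have := covE w.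
  have h1 := outdegU (F :|: P) Q w; have h2 := outdegU F P w.
  have hP : outdeg P w <= (w == u).
    case: eqVneq => [->|wu]; last first.
      rewrite outdeg0 // => b; apply/negP => /(subsetP sP); apply/negP; exact: Trtail.
    exact: leq_trans (leq_addr _ _) (leq_trans (outdeg_arcs u up) (leq_b1 _)).
  have hQ : outdeg Q w <= (w == v).
    case: eqVneq => [->|wv]; last first.
      rewrite outdeg0 // => b; apply/negP => /(subsetP sQ); apply/negP; exact: Trtail'.
    exact: leq_trans (leq_addr _ _) (leq_trans (outdeg_arcs v uq) (leq_b1 _)).
  move: h1 h2 hP hQ; rewrite -/F' !inE.
  have [wu|_] := eqVneq w u; have [wv|_] := eqVneq w v; rewrite ?orbT ?orbF;
    do ?[by rewrite -wu -wv eqxx in uv]; clear; lia.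
(* A half-path leaves [z] only if it enters it, and at its last vertex the arc of the bridge takes
   the place of the outgoing arc. *)
- move=> z zZ; have h0 := st_outW st zZ.
  have zu : z != u by apply: contraNneq zZ => ->; apply: MZ.
  have zv : z != v by apply: contraNneq zZ => ->; apply: MZ.
  have dFP : [disjoint F & P].
    by rewrite disjoint_sym disjoint_subset; apply/subsetP => -[a b] /PTr[_ _ _]; rewrite inE.
  have dFPQ : [disjoint F :|: P & Q].
    rewrite disjoint_sym disjoint_subset; apply/subsetP => -[a b] /QTr[_ _ _].
    rewrite !inE !negb_or => /andP[-> /= nT]; apply: contra nT; exact: (subsetP sP).
  rewrite /F' indegU // indegU //.
  have h1 := outdegU (F :|: P) Q z; have h2 := outdegU F P z.
  have h3 := outdegU ([set (x, y)] :|: [set (y, x)]) Ec z.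
  have := outdegU [set (x, y)] [set (y, x)] z; rewrite !outdeg1.
  have := outdeg_arcs z up; rewrite lp inE (negPf zu) /=.
  have := outdeg_arcs z uq; rewrite lq inE (negPf zv) /=.
  have := indeg_arcs u p z; have := indeg_arcs v q z.
  move: h0 h1 h2 h3; rewrite -/P -/Q -/Ec'.
  case: (z == x); case: (z == y); case: (z \in p); case: (z \in q); clear; rewrite /reverse_coercion; lia.
- by move=> a b; rewrite !inE !xpair_eqE -in_setU => /orP[/orP[/andP[/eqP -> _]|/andP[/eqP -> _]]|/(st_EcZ st)].
have cP := card_arcs u p; have cQ := card_arcs v q; rewrite -/P in cP; rewrite -/Q in cQ.
have [cF1 _] := leq_card_setU (F :|: P) Q; have [cF2 _] := leq_card_setU F P.
have [cE1 _] := leq_card_setU ([set (x, y)] :|: [set (y, x)]) Ec.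
have [cE2 _] := leq_card_setU [set (x, y)] [set (y, x)]; rewrite !cards1 in cE2.
have eqS : (H + 2) * \sum_(w in M) udeg M (Dn :|: [set [set u; v]]) w + 2 * (H + 2)
    = (H + 2) * \sum_(w in M) udeg M Dn w by rewrite -sumD [RHS]mulnDr [2 * _]mulnC.
move: (st_card st) cP cQ cF1 cF2 cE1 cE2 eqS sp sp0 sq sq0.
rewrite -/F' -/Ec'; clear.
move: (_ * \sum_(w in M) _) (_ * \sum_(w in M) _) => s1 s2.
rewrite /reverse_coercion; lia.
Qed.

Lemma state_init : exists Dn UE, state Dn UE set0 set0.
Proof.
have [Dn [UE [pk deg0]]] := packing_init M esym eirr.
have out0 z : outdeg set0 z = 0 :> nat by apply: outdeg0 => y; rewrite inE.
exists Dn, UE; split=> //; rewrite ?cards0.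
- exact: pk_routed pk.
- move=> x y xyU; left; apply: contraLR xyU; rewrite negb_and.
  have [xM|xM] := boolP (x \in M); have [yM|yM] := boolP (y \in M) => // _.
  + by apply: (pk_fresh pk) => //; rewrite inE.
  + by rewrite setUC; apply: (pk_fresh pk) => //; rewrite inE.
  + by apply: (pk_WW pk); rewrite inE.
- by move=> x y; rewrite inE.
- by move=> y; rewrite /indeg eq_card0 // => x; rewrite !inE.
- by move=> u uM; rewrite out0 add0n deg0.
- by move=> z _; rewrite !out0.
- by move=> x y; rewrite inE.
rewrite !add0n leq_mul2l -sum_nat_const leq_sum ?orbT // => u uM.
by move: (deg0 u uM); clear; lia.
Qed.

Lemma sparse_complete : exists Dn UE, routed e Dn UE /\
  forall x y, x \in M -> y \in M -> x != y -> [set x; y] \in Dn.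
Proof.
have [Dn [UE st]] := state_init; move E : (\sum_(x in M) udeg M Dn x) => s.
move: (set0 : {set T * T}) {1}(set0 : {set T * T}) st E.
elim/ltn_ind: s Dn UE => s IH Dn UE Ec F st E.
have [/existsP[u /existsP[v uruv]]|full] := boolP [exists u, [exists v, unrouted M Dn u v]].
  have [Dn' [UE' [F' [Ec' [st' sE]]]]] := state_step st uruv.
  apply: (IH (\sum_(x in M) udeg M Dn' x) _ Dn' UE' Ec' F') => //.
  by rewrite -E -sE; clear; lia.
exists Dn, UE; split; first exact: st_routed st.
move=> x y xM yM xy; move/existsPn: full => /(_ x)/existsPn/(_ y).
by rewrite /unrouted xM yM xy /= negbK.
Qed.

End Sparse.

Local Open Scope ring_scope.

(** * Spectral gap and edge distribution *)

Section NormalMatrix.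
Local Open Scope sesquilinear_scope.
Variables (C : numClosedFieldType) (n : nat).
Implicit Types (A P : 'M[C]_n) (x o : 'rV[C]_n).

Lemma char_poly_similar_diag A P (D : 'rV[C]_n) : P \in unitmx ->
  A = invmx P *m diag_mx D *m P -> char_poly A = \prod_i ('X - (D 0 i)%:P).
Proof.
move=> Pu ->; rewrite /char_poly /char_poly_mx.
have mP : map_mx polyC P \in unitmx by rewrite map_unitmx.
have -> : 'X%:M - map_mx polyC (invmx P *m diag_mx D *m P) =
   invmx (map_mx polyC P) *m ('X%:M - map_mx polyC (diag_mx D)) *m map_mx polyC P.
  rewrite mulmxBr mulmxBl !map_mxM map_invmx; congr (_ - _).
  by rewrite -mulmxA mul_scalar_mx -scalemxAr mulVmx // scalemx1.
rewrite !det_mulmx mulrAC -det_mulmx mulVmx // det1 mul1r.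
rewrite map_diag_mx -diag_const_mx -linearB /= det_diag.
by apply: eq_bigr => i _; rewrite !mxE.
Qed.

(** In an orthonormal eigenbasis, [o] is supported on indices with eigenvalue [d]. Since the modulus
    of [d] exceeds [lam], only the exceptional index qualifies, and orthogonality to [o] kills that
    coordinate of [x]; all others are scaled by at most [lam]. *)
Lemma normal_mx_bound A (mu : 'I_n -> C) (i0 : 'I_n) (lam d : C) o x :
  A \is normalmx -> char_poly A = \prod_i ('X - (mu i)%:P) ->
  (forall i, i != i0 -> `|mu i| <= lam) -> ~~ (`|d| <= lam) ->
  o *m A = d *: o -> o != 0 -> x *m o^t* = 0 ->
  (x *m A *m (x *m A)^t*) 0 0 <= lam ^+ 2 * (x *m x^t*) 0 0.
Proof.
move=> /orthomx_spectralP; set P := spectralmx A; set D := spectral_diag A => EA.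
have Pun : P \is unitarymx := spectral_unitarymx A.
have Pu := unitarymx_unit Pun.
rewrite (char_poly_similar_diag Pu EA) => chE mu_le dlam oA o0 xo.
have {chE} /tuple_permP[s Ds] : perm_eq [tuple D 0 i | i < n] [tuple mu i | i < n].
  by apply: prod_XsubC_eq; rewrite !big_tuple;
     under eq_bigr do rewrite tnth_mktuple;
     under [RHS]eq_bigr do rewrite tnth_mktuple.
have {}Ds i : D 0 i = mu (s i).
  have /(congr1 (fun t => nth 0 t i)) := Ds.
  by rewrite -!tnth_nth !tnth_mktuple.
have Vi : invmx P = P^t* by apply: invmx_unitary.
have norm_eq (y : 'rV[C]_n) : y *m y^t* = y *m P^t* *m (y *m P^t*)^t*.
  rewrite trmx_mul map_mxM trmxCK mulmxA -(mulmxA y) -Vi mulVmx //.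
  by rewrite mulmx1.
have sq_sum (y : 'rV[C]_n) : (y *m y^t*) 0 0 = \sum_i `|y 0 i| ^+ 2.
  by rewrite mxE; apply: eq_bigr => i _; rewrite !mxE normCK.
set z := x *m P^t*; set w := o *m P^t*.
have AP : A *m P^t* = P^t* *m diag_mx D.
  by rewrite EA -Vi -!mulmxA mulmxV // mulmx1.
have wD i : D 0 i != d -> w 0 i = 0.
  move=> Did; have : w *m diag_mx D = d *: w.
    by rewrite -mulmxA -AP mulmxA oA scalemxAl.
  move=> /matrixP/(_ 0 i); rewrite mul_mx_diag !mxE -/w mulrC.
  move/eqP; rewrite -subr_eq0 -mulrBl mulf_eq0 subr_eq0 (negPf Did) /=.
  by move/eqP.
have [i1 wi1] : exists i, w 0 i != 0.
  apply/existsP; apply: contraNT o0 => /existsPn w0.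
  have w00 : w = 0.
    by apply/rowP => i; move: (w0 i); rewrite negbK => /eqP ->; rewrite mxE.
  have -> : o = w *m P by rewrite -mulmxA -Vi mulVmx // mulmx1.
  by rewrite w00 mul0mx.
have Di1 : D 0 i1 = d by apply: contraNeq wi1 => /wD ->.
have si1 : s i1 = i0.
  by apply: contraNeq dlam => /mu_le; rewrite -Ds Di1.
have Dle i : i != i1 -> `|D 0 i| <= lam.
  by move=> ii1; rewrite Ds mu_le // -si1 (inj_eq perm_inj).
have zi1 : z 0 i1 = 0.
  have : z *m w^t* = 0.
    rewrite trmx_mul map_mxM trmxCK mulmxA -(mulmxA x) -Vi mulVmx //.
    by rewrite mulmx1.
  move=> /matrixP/(_ 0 0); rewrite !mxE (bigD1 i1) //= big1 => [|i ii1].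
    rewrite addr0 !mxE => /eqP; rewrite mulf_eq0 conjC_eq0.
    by case/orP => /eqP // h; case/eqP: wi1; rewrite -h !mxE.
  have wi : w 0 i = 0.
    apply: wD; apply: contraNneq dlam => <-; exact: Dle.
  by rewrite [w^t* _ _]mxE [w^T _ _]mxE wi conjC0 mulr0.
have xAP : x *m A *m P^t* = z *m diag_mx D by rewrite -mulmxA AP mulmxA.
rewrite (norm_eq (x *m A)) xAP (norm_eq x) -/z !sq_sum mulr_sumr.
apply: ler_sum => i _; rewrite mul_mx_diag mxE normrM exprMn mulrC.
have [->|ii1] := eqVneq i i1; first by rewrite zi1 normr0 expr0n /= !mulr0.
by rewrite ler_wpM2r ?exprn_ge0 // ler_pXn2r ?nnegrE // ?(le_trans _ (Dle i ii1)) ?Dle.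
Qed.

End NormalMatrix.

Section Mixing.
Variables (R : realType) (n d : nat) (lam : R) (e : rel 'I_n).
Hypotheses (Gndl : ndl_graph d lam e) (lamd : lam < d%:R).

Local Notation toC := (real_complex R).

Lemma map_real_dot m (y : 'rV[R]_m) (Y := map_mx toC y) :
  (Y *m map_mx Num.conj Y^T) 0 0 = toC (\sum_i y 0 i ^+ 2).
Proof.
rewrite mxE rmorph_sum; apply: eq_bigr => i _; rewrite !mxE.
by rewrite conj_Creal ?complex_real ?rmorphXn //= expr2.
Qed.

Lemma degin_sum (S : {set 'I_n}) x : (degin e S x)%:R = \sum_(y in S) (e x y)%:R :> R.
Proof.
rewrite /degin -sum1_card natr_sum [RHS]big_mkcond [LHS]big_mkcond /=.
by apply: eq_bigr => y _; rewrite !inE; case: (y \in S); case: (e x y).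
Qed.

Lemma deg_sum (K : pzRingType) x :
  \sum_y (e x y)%:R = #|[set w | e x w]|%:R :> K.
Proof.
rewrite -natr_sum; congr _%:R; rewrite -sum1_card [RHS]big_mkcond /=.
by apply: eq_bigr => i _; rewrite inE; case: (e x i).
Qed.

(** The test vector is the indicator of [S] minus its mean: it is orthogonal to the constant
    eigenvector, the adjacency matrix sends it to the deviations on the left, and its squared norm
    is at most [#|S|]. The passage to complex numbers gives access to the spectral theorem. *)
Lemma degin_variance (S : {set 'I_n}) :
  \sum_x ((degin e S x)%:R - d%:R * #|S|%:R / n%:R) ^+ 2 <= lam ^+ 2 * #|S|%:R.
Proof.
have [[sym irr] [reg [mu [chE [i0 [_ mule]]]]]] := Gndl.
have n0 : n%:R != 0 :> R by rewrite pnatr_eq0 -lt0n (leq_ltn_trans _ (ltn_ord i0)).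
set A := adjmx R e; set c : R := #|S|%:R / n%:R.
set y : 'rV[R]_n := \row_i ((i \in S)%:R - c).
have yA j : (y *m A) 0 j = (degin e S j)%:R - d%:R * #|S|%:R / n%:R.
  rewrite mxE; under eq_bigr do rewrite !mxE mulrBl sym.
  rewrite sumrB -mulr_sumr; congr (_ - _); last first.
    rewrite mulrC -(reg j) mulrA; congr (_ * _ / _).
    exact: deg_sum.
  rewrite degin_sum [RHS]big_mkcond /=; apply: eq_bigr => i _.
  by case: (i \in S); rewrite ?mul1r ?mul0r.
pose Ac := map_mx toC A; pose o : 'rV[R[i]%C]_n := const_mx 1.
have Anorm : Ac \is normalmx.
  apply: hermitian_normalmx; apply: realsym_hermsym.
    by apply/is_hermitianmxP; rewrite expr0 scale1r map_mx_id //; apply/matrixP => i j; rewrite !mxE sym.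
  by apply/mxOverP => i j; rewrite !mxE complex_real.
have cS : \sum_i (i \in S)%:R = #|S|%:R :> R.
  by rewrite -natr_sum -sum1_card [X in _ = X%:R]big_mkcond.
have := @normal_mx_bound _ _ Ac (fun i => toC (mu i)) i0 (toC lam) (toC d%:R) o
  (map_mx toC y) Anorm.
have -> : char_poly Ac = \prod_i ('X - (toC (mu i))%:P).
  rewrite -map_char_poly chE rmorph_prod; apply: eq_bigr => i _.
  by rewrite /= map_polyXsubC.
move=> /(_ erefl).
have normC (r : R) : `|toC r| = toC `|r|.
  by rewrite normc_def /= expr0n /= addr0 sqrtr_sqr.
have le1 i : i != i0 -> `|toC (mu i)| <= toC lam.
  by move=> /mule h; rewrite normC lecR.
have le2 : ~~ (`|toC d%:R| <= toC lam) by rewrite normC lecR -ltNge ger0_norm.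
have oA : o *m Ac = toC d%:R *: o.
  apply/rowP => j; rewrite !mxE -(reg j) mulr1 rmorph_nat.
  under eq_bigr do rewrite !mxE mul1r sym rmorph_nat.
  exact: deg_sum.
have o0 : o != 0.
  by apply/eqP => /rowP/(_ i0); rewrite !mxE; apply/eqP; exact: oner_neq0.
have yo : map_mx toC y *m map_mx Num.conj o^T = 0.
  apply/matrixP => a b; rewrite !ord1 !mxE.
  under eq_bigr do rewrite !mxE rmorph1 mulr1.
  rewrite -rmorph_sum sumrB cS sumr_const card_ord -[c *+ _]mulr_natr /c divfK //.
  by rewrite subrr rmorph0.
move=> /(_ le1 le2 oA o0 yo).
rewrite -map_mxM !map_real_dot -rmorphXn -rmorphM lecR.
under eq_bigr do rewrite yA.
move=> /le_trans; apply; apply: ler_wpM2l; first exact: sqr_ge0.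
have -> : \sum_i y 0 i ^+ 2 = #|S|%:R - n%:R * c ^+ 2.
  have -> : n%:R * c ^+ 2 = c * #|S|%:R *+ 2 - c ^+ 2 *+ n.
    by rewrite -[_ *+ n]mulr_natr /c; field.
  under eq_bigr do rewrite mxE sqrrB.
  rewrite big_split /= sumrB sumr_const card_ord.
  have -> : \sum_(i < n) ((i \in S)%:R : R) ^+ 2 = #|S|%:R.
    by rewrite -cS; apply: eq_bigr => i _; case: (i \in S); rewrite ?expr1n ?expr0n.
  have -> : \sum_(i < n) ((i \in S)%:R * c) *+ 2 = c * #|S|%:R *+ 2.
    by rewrite sumrMnl -mulr_suml cS mulrC.
  by rewrite opprB addrA addrAC.
by rewrite gerBl mulr_ge0 ?sqr_ge0.
Qed.

End Mixing.

(** * Dense case: common neighbours and near-regular matchings *)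

(* Choose the signs one at a time, each making the cross term nonpositive. *)
Lemma balanced_signs (R : realDomainType) (T I : finType) (A : {set I})
    (l : seq T) (a : T -> I -> R) : uniq l ->
  exists s : T -> bool,
    \sum_(u in A) (\sum_(v <- l) (-1) ^+ s v * a v u) ^+ 2
      <= \sum_(u in A) \sum_(v <- l) a v u ^+ 2.
Proof.
elim: l => [|v l IH] /=.
  by exists (fun=> false); apply: ler_sum => u _; rewrite !big_nil expr0n.
case/andP=> vl /IH[s hs].
pose c := \sum_(u in A) (\sum_(w <- l) (-1) ^+ s w * a w u) * a v u.
exists (fun w => if w == v then (0 <= c)%R else s w).
under eq_bigr => u _.
  rewrite big_cons eqxx (eq_big_seq (fun w => (-1) ^+ s w * a w u)); last first.
    by move=> w wl; case: eqVneq => // wv; rewrite -wv wl in vl.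
  rewrite sqrrD exprMn sqrr_sign mul1r.
  rewrite (_ : _ *+ 2 = ((-1) ^+ (0 <= c)%R * ((\sum_(w <- l) (-1) ^+ s w * a w u) * a v u)) *+ 2); last by rewrite mulrAC mulrA.
  over.
under [X in _ <= X]eq_bigr => u _ do rewrite big_cons.
rewrite !big_split /= lerD // -[leRHS]addr0 lerD2l.
rewrite -mulr_sumr -/c -mulr2n.
rewrite pmulrn_lle0 //.
by case: (lerP 0 c) => c0 /=; rewrite ?expr1 ?expr0 ?mulN1r ?oppr_le0 // mul1r ltW.
Qed.

Section NearRegularMatching.
Variables (R : realType) (T : finType) (h : rel T) (A : {set T}) (D th : R).
Hypotheses (hsym : symmetric h) (D0 : 0 < D) (th0 : 0 < th).

(** Plays the role of Cauchy-Schwarz when a second-moment bound is turned into a first-moment one;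
    [s] is chosen at each use. *)
Lemma abs_le_sqr (x s : R) : 0 < s -> `|x| <= x ^+ 2 / s + s.
Proof.
move=> s0; rewrite -[x ^+ 2]real_normK ?num_real //.
have [xs|xs] := lerP `|x| s.
  by rewrite (le_trans xs) // lerDr divr_ge0 ?sqr_ge0 // ltW.
apply: ler_wpDr; first exact: ltW.
rewrite ler_pdivlMr // [leRHS]expr2.
by rewrite ler_wpM2l // ltW.
Qed.

Lemma double_count (B B' : {set T}) :
  \sum_(u in B) (degin h B' u)%:R = \sum_(u in B') (degin h B u)%:R :> R.
Proof.
have E (X : {set T}) u : (degin h X u)%:R = \sum_(v in X) (h u v)%:R :> R.
  rewrite /degin -sum1_card natr_sum [RHS]big_mkcond [LHS]big_mkcond /=.
  by apply: eq_bigr => y _; rewrite !inE; case: (y \in X); case: (h u y).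
under eq_bigr do rewrite E; under [RHS]eq_bigr do rewrite E.
rewrite exchange_big; apply: eq_bigr => u _; apply: eq_bigr => v _.
by rewrite hsym.
Qed.

(** The signs split [A] so that most vertices have about [D / 2] neighbours in each half. Counting
    edges between a set and its neighbourhood from both sides then bounds the deficiency in Hall's
    theorem, and the same count shows the halves to be nearly equal. *)
Lemma near_regular_matching (y0 : T) :
  exists (X : {set T}) (g : T -> T), [/\ X \subset A, {in X &, injective g},
    forall x, x \in X -> (g x \in A :\: X) && h x (g x) &
    (#|A|%:R - 2 * #|X|%:R) * D <=
      3 * (\sum_(u in A) `|(degin h A u)%:R - D| + #|A|%:R ^+ 2 / th + th * #|A|%:R)].
Proof.
have [s hs] := balanced_signs A (fun v u => (h u v && (v \in A))%:R : R) (enum_uniq T).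
pose X0 := [set u in A | ~~ s u]; pose Y0 := [set u in A | s u].
pose sg u : R := (degin h X0 u)%:R - (degin h Y0 u)%:R.
have X0A : X0 \subset A by apply/subsetP => u; rewrite inE => /andP[].
have Y0A : Y0 \subset A by apply/subsetP => u; rewrite inE => /andP[].
have sgE u : \sum_(v <- enum T) (-1) ^+ s v * (h u v && (v \in A))%:R = sg u.
  rewrite big_enum /= /sg /degin -!sum1_card !natr_sum.
  rewrite [X in X - _]big_mkcond [X in _ - X]big_mkcond -sumrB; apply: eq_bigr => v _.
  rewrite !inE; case: (v \in A); case: (h u v); case: (s v) => /=;
  by rewrite ?expr0 ?expr1 ?mul1r ?mulr1 ?mulr0 ?subr0 ?sub0r ?subrr.
have fE u : (degin h A u)%:R = (degin h X0 u)%:R + (degin h Y0 u)%:R :> R.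
  rewrite -natrD; congr _%:R; rewrite /degin -cardsUI [X in (_ + X)%N]eq_card0 ?addn0.
    by apply: eq_card => v; rewrite !inE; case: (v \in A); case: (s v); rewrite ?andbF ?orbF.
  by move=> v; rewrite !inE; case: (s v); rewrite /= ?andbF.
have degA u : ((degin h A u)%:R : R) <= #|A|%:R.
  by rewrite ler_nat subset_leq_card //; apply/subsetP => v; rewrite inE => /andP[].
(* The squares of 0-1 entries sum to the degrees inside [A], each at most [#|A|]. *)
have sg2 : \sum_(u in A) sg u ^+ 2 <= #|A|%:R ^+ 2.
  under eq_bigr do rewrite -sgE.
  apply: (le_trans hs); rewrite expr2 [leRHS]mulr_natr -sumr_const.
  apply: ler_sum => u _; apply: le_trans (degA u).
  rewrite big_enum /= /degin -sum1_card natr_sum [leRHS]big_mkcond /=.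
  by apply: ler_sum => v _; rewrite inE; case: (v \in A); case: (h u v); rewrite ?expr1n ?expr0n.
have sg1 : \sum_(u in A) `|sg u| <= #|A|%:R ^+ 2 / th + th * #|A|%:R.
  apply: (le_trans (ler_sum _ (fun u _ => abs_le_sqr (sg u) th0))).
  rewrite big_split /= -mulr_suml lerD ?ler_wpM2r ?invr_ge0 ?(ltW th0) //.
  by rewrite sumr_const mulr_natr.
pose xi u := (`|(degin h A u)%:R - D| + `|sg u|) / 2.
have xi0 u : 0 <= xi u by rewrite divr_ge0 ?addr_ge0.
have half (x y : R) : `|x / 2 + y / 2| <= (`|x| + `|y|) / 2.
  have h2 : (0 : R) <= 2^-1 by rewrite invr_ge0.
  by rewrite -mulrDl normrM (ger0_norm h2) ler_wpM2r // ler_normD.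
have xiX u : `|(degin h X0 u)%:R - D / 2| <= xi u.
  have -> : (degin h X0 u)%:R - D / 2 = ((degin h A u)%:R - D) / 2 + sg u / 2.
    by rewrite fE /sg; field.
  exact: half.
have xiY u : `|(degin h Y0 u)%:R - D / 2| <= xi u.
  have -> : (degin h Y0 u)%:R - D / 2 = ((degin h A u)%:R - D) / 2 - sg u / 2.
    by rewrite fE /sg; field.
  by rewrite -mulNr (le_trans (half _ _)) // normrN.
pose E := \sum_(u in A) xi u.
have E0 : 0 <= E by apply: sumr_ge0.
have split_le (B1 B2 : {set T}) : B1 \subset A -> B2 \subset A -> [disjoint B1 & B2] ->
    \sum_(u in B1) xi u + \sum_(u in B2) xi u <= E.
  move=> s1 s2 d12; rewrite /E [leRHS](big_setID B1) /= (setIidPr s1) lerD2l.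
  have s2' : B2 \subset A :\: B1 by rewrite subsetD s2 disjoint_sym.
  by rewrite [leRHS](big_setID B2) /= (setIidPr s2') lerDl sumr_ge0.
have lowsum (B B' : {set T}) : (forall u, `|(degin h B' u)%:R - D / 2| <= xi u) ->
   D / 2 * #|B|%:R - \sum_(u in B) xi u <= \sum_(u in B) (degin h B' u)%:R.
  move=> hB; rewrite lerBlDr -big_split /= mulr_natr -sumr_const.
  apply: ler_sum => u _; have := hB u; rewrite ler_norml => /andP[]; lra.
have upsum (B B' : {set T}) : (forall u, `|(degin h B' u)%:R - D / 2| <= xi u) ->
   \sum_(u in B) (degin h B' u)%:R <= D / 2 * #|B|%:R + \sum_(u in B) xi u.
  move=> hB; rewrite mulr_natr -sumr_const -big_split /=.
  apply: ler_sum => u _; have := hB u; rewrite ler_norml => /andP[]; lra.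
have disjXY : [disjoint X0 & Y0].
  rewrite -setI_eq0; apply/eqP/setP => u; rewrite !inE.
  by case: (s u); rewrite ?andbF.
pose k := Num.truncn (2 * E / D).
have kE : k%:R <= 2 * E / D.
  by have /andP[] := truncn_itv (divr_ge0 (mulr_ge0 (ler0n _ 2) E0) (ltW D0)).
have Hall (S : {set T}) : S \subset X0 -> (#|S| <= #|nbhd h S Y0| + k)%N.
  move=> sS; set N := nbhd h S Y0.
  have sN : N \subset Y0 by apply/subsetP => y; rewrite inE => /andP[].
  have e1 : \sum_(u in S) (degin h Y0 u)%:R <= \sum_(u in N) (degin h X0 u)%:R :> R.
    have -> : \sum_(u in S) (degin h Y0 u)%:R = \sum_(u in S) (degin h N u)%:R :> R.
      apply: eq_bigr => u uS; congr _%:R; apply: eq_card => v; rewrite [LHS]inE [RHS]inE.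
      case huv: (h u v); rewrite ?andbF // !andbT [RHS]inE.
      by case: (v \in Y0) => //=; apply/esym/existsP; exists u; rewrite uS.
    rewrite double_count; apply: ler_sum => u _; rewrite ler_nat.
    apply: subset_leq_card; apply/subsetP => v; rewrite inE => /andP[vS huv].
    by rewrite inE huv (subsetP sS).
  have := le_trans (lowsum S _ xiY) (le_trans e1 (upsum N _ xiX)).
  have dSN : [disjoint S & N] by apply: disjointWl sS _; apply: disjointWr sN _.
  have := split_le S N (subset_trans sS X0A) (subset_trans sN Y0A) dSN.
  move=> h1 h2; have h3 : (#|S|%:R - #|N|%:R) * D <= 2 * E by lra.
  rewrite leqNgt; apply/negP; rewrite -ltnS => lt.
  have : (2 * E / D) < k.+1%:R.
    by have /andP[] := truncn_itv (divr_ge0 (mulr_ge0 (ler0n _ 2) E0) (ltW D0)).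
  apply/negP; rewrite -leNgt ler_pdivlMr //; apply: le_trans h3; rewrite ler_wpM2r ?(ltW D0) //.
  by rewrite lerBrDr -natrD ler_nat addSn addnC.
have [X [g [sX ig hg cX]]] := hall_deficiency y0 Hall.
exists X, g; split=> //; first exact: subset_trans X0A.
  move=> x xX; have /andP[gY ->] := hg x xX; rewrite andbT inE (subsetP Y0A) // andbT.
  apply/negP => /(subsetP sX) gX; have := disjointFr disjXY gX.
  by rewrite gY.
have eXY : D / 2 * #|Y0|%:R <= D / 2 * #|X0|%:R + E.
  have := le_trans (lowsum Y0 X0 xiX) (_ : _ <= _ ); rewrite double_count => /(_ _ (upsum X0 Y0 xiY)).
  by have := split_le X0 Y0 X0A Y0A disjXY; lra.
have cA : #|A|%:R = #|X0|%:R + #|Y0|%:R :> R.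
  rewrite -natrD; congr _%:R; rewrite -cardsUI [X in (_ + X)%N]eq_card0 ?addn0.
    by apply: eq_card => v; rewrite !inE; case: (v \in A); case: (s v).
  by move=> v; rewrite !inE; case: (s v); rewrite /= ?andbF.
have cX' : #|X0|%:R <= #|X|%:R + 2 * E / D.
  by rewrite (le_trans _ (lerD (lexx _) kE)) // -natrD ler_nat.
have {}cX' : #|X0|%:R * D <= #|X|%:R * D + 2 * E.
  by move: cX'; rewrite -(ler_pM2r D0) mulrDl divfK // gt_eqF.
have EE : 2 * E <= \sum_(u in A) `|(degin h A u)%:R - D| + #|A|%:R ^+ 2 / th + th * #|A|%:R.
  have -> : 2 * E = \sum_(u in A) `|(degin h A u)%:R - D| + \sum_(u in A) `|sg u|.
    rewrite /E -big_split mulr_sumr; apply: eq_bigr => u _ /=.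
    by rewrite /xi mulrC divfK ?pnatr_eq0.
  by rewrite -addrA lerD2l.
(* The unmatched part of [X0] costs [2 * E] and is counted twice; the imbalance between [X0] and
   [Y0] costs another [2 * E]. *)
apply: le_trans (_ : 3 * (2 * E) <= _); last by rewrite ler_pM2l.
rewrite cA; lra.
Qed.

End NearRegularMatching.

Lemma degin_mix (R : realType) n d (lam : R) (e : rel 'I_n) (s : R) (U S : {set 'I_n}) :
  ndl_graph d lam e -> lam < d%:R -> 0 < s ->
  \sum_(x in U) `|(degin e S x)%:R - d%:R / n%:R * #|S|%:R|
    <= lam ^+ 2 * #|S|%:R / s + s * #|U|%:R.
Proof.
move=> G ld s0; apply: (le_trans (ler_sum _ (fun x _ => abs_le_sqr _ s0))).
rewrite big_split /= lerD //; last by rewrite sumr_const mulr_natr.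
rewrite -mulr_suml ler_wpM2r ?invr_ge0 ?(ltW s0) //.
apply: le_trans (degin_variance G ld S); rewrite [leRHS](bigID (mem U)) /=.
rewrite -[leLHS]addr0 lerD //; last by apply: sumr_ge0 => x _; apply: sqr_ge0.
by apply: ler_sum => x _; rewrite mulrAC.
Qed.

(** * Error control for the packing of paths of length two *)

Section Dense.
Variables (R : realType) (n d : nat) (e : rel 'I_n) (M : {set 'I_n}).
Variables (p del eps eta C : R).
Hypotheses (esym : symmetric e) (eirr : irreflexive e).
Hypothesis reg : forall u, #|[set w | e u w]| = d.
Hypothesis mix : forall S : {set 'I_n},
  \sum_x `|(degin e S x)%:R - p * #|S|%:R| <= del * n%:R ^+ 2.
Hypotheses (p0 : 0 < p) (Cp : 1 <= C * p) (dE : d%:R = p * n%:R).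
Hypotheses (eta0 : 0 < eta) (slack : 5 * eta * d%:R <= d%:R - #|M|%:R).
Hypotheses (eps0 : 0 < eps) (del0 : 0 < del) (del1 : del <= 1) (n_large : 1 <= del ^+ 2 * n%:R).
Local Notation W := (~: M).
Local Notation N := (n%:R : R).
Implicit Types (Dn UE : {set {set 'I_n}}) (Wt : {set 'I_n}).

(** Heuristic value of [udeg]: a proportion [p] of the partners is adjacent, and each middle vertex
    serves a branch vertex with frequency [p]. *)
Let target Wt : R := (1 - p) * #|M|%:R - p * #|Wt|%:R.
Let excess Dn Wt : R := \sum_(u in M)
  ((udeg M Dn u)%:R + (degin e Wt u)%:R + (degin e M u)%:R + 1 - #|M|%:R).
(** Chosen so that, after adding [del3 * N ^+ 2] to [excess], the additive errors of one round are
    absorbed and the recursion becomes multiplicative. *)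
Let del3 := del * (3 + C * (2 + (5 * eta)^-1)).

Let n0 : 0 < N.
Proof. by have := n_large; rewrite ltr0n lt0n; case: eqP => // ->; rewrite mulr0 ler10. Qed.

Let MN : #|M|%:R <= N.
Proof. by rewrite ler_nat -[X in (_ <= X)%N]card_ord max_card. Qed.

Let small1 : N <= del * N ^+ 2.
Proof.
rewrite expr2 mulrA ler_peMl ?(ltW n0) //; apply: le_trans n_large _.
by rewrite ler_wpM2r ?(ltW n0) // expr2 ler_piMl // ltW.
Qed.

Let mixM (S : {set 'I_n}) :
  \sum_(x in M) `|(degin e S x)%:R - p * #|S|%:R| <= del * N ^+ 2.
Proof.
apply: le_trans (mix S); rewrite [leRHS](bigID (mem M)) /= lerDl.
by apply: sumr_ge0.
Qed.

Lemma udeg_deviation Dn UE Wt : packing e M Dn UE Wt ->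
  \sum_(u in M) `|(udeg M Dn u)%:R - target Wt| <= excess Dn Wt + N + 2 * (del * N ^+ 2).
Proof.
move=> pk; have h1 := mixM M; have h2 := mixM Wt.
have h3 : \sum_(u in M) (1 : R) <= N by rewrite sumr_const.
apply: le_trans (_ : excess Dn Wt + \sum_(u in M) (1 : R)
  + (\sum_(x in M) `|(degin e M x)%:R - p * #|M|%:R|
     + \sum_(x in M) `|(degin e Wt x)%:R - p * #|Wt|%:R|) <= _); last by lra.
rewrite /excess -!big_split /=; apply: ler_sum => u uM.
have : (#|M|%:R : R) <= (udeg M Dn u)%:R + (degin e Wt u)%:R + (degin e M u)%:R + 1.
  by rewrite -!natrD natr1 -addn1 ler_nat; exact: pk_miss pk _ uM.
rewrite /target; set a := (udeg M Dn u)%:R; set b := (degin e Wt u)%:R.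
set c := (degin e M u)%:R; set m := #|M|%:R; set t := #|Wt|%:R.
move=> h.
have := ler_norm (c - p * m); have := ler_norm (- (c - p * m)).
have := ler_norm (b - p * t); have := ler_norm (- (b - p * t)).
rewrite !normrN => g1 g2 g3 g4.
by rewrite ler_norml; apply/andP; split; lra.
Qed.

Lemma good_middle Dn UE Wt : packing e M Dn UE Wt -> eps * N <= target Wt ->
  exists w, [/\ w \in W, w \notin Wt &
   \sum_(u in M) `|(degin e [set y | unrouted M Dn u y] w)%:R - p * (udeg M Dn u)%:R|
     <= del * N ^+ 2 / (5 * eta)].
Proof.
move=> pk tg; set F := fun w u => `|(degin e [set y | unrouted M Dn u y] w)%:R - p * (udeg M Dn u)%:R|.
pose ok w := [&& w \in W, w \notin Wt & \sum_(u in M) F w u <= del * N ^+ 2 / (5 * eta)].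
suff /existsP[w /and3P[]] : [exists w, ok w] by exists w.
apply: contraT => /existsPn bad.
(* Nonnegativity of [target Wt] gives [p * (N - #|M| - #|Wt|) >= p * N - #|M| = d - #|M|], to which
   [slack] applies. *)
have cW : 5 * eta * N <= #|W :\: Wt|%:R.
  have sW := pk_W pk.
  have cE : #|W :\: Wt|%:R = N - #|M|%:R - #|Wt|%:R :> R.
    rewrite cardsD (setIidPr sW) natrB ?subset_leq_card //.
    by rewrite cardsCs setCK card_ord natrB // -[X in (_ <= X)%N]card_ord max_card.
  have tg0 : 0 <= target Wt by apply: le_trans tg; rewrite mulr_ge0 ?ltW.
  rewrite -(ler_pM2l p0) cE; move: slack tg0; rewrite /target dE.
  set m := #|M|%:R; set t := #|Wt|%:R; nra.
have big : \sum_(w in W :\: Wt) \sum_(u in M) F w u <= N * (del * N ^+ 2).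
  rewrite exchange_big /=; apply: le_trans (_ : \sum_(u in M) del * N ^+ 2 <= _).
    apply: ler_sum => u _; apply: le_trans (mix [set y | unrouted M Dn u y]).
    rewrite [leRHS](bigID (mem (W :\: Wt))) /= lerDl; exact: sumr_ge0.
  by rewrite sumr_const -[leLHS]mulr_natl ler_wpM2r // mulr_ge0 ?sqr_ge0 ?ltW.
have WW0 : (0 < #|W :\: Wt|)%N.
  by rewrite -(ltr_nat R); apply: lt_le_trans cW; rewrite !mulr_gt0.
have : \sum_(w in W :\: Wt) \sum_(u in M) F w u > N * (del * N ^+ 2).
  apply: (@le_lt_trans _ _ (\sum_(w in W :\: Wt) (del * N ^+ 2 / (5 * eta)))).
    have e0 : 0 < 5 * eta by rewrite mulr_gt0.
    rewrite sumr_const -[leRHS]mulr_natr mulrAC ler_pdivlMr //.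
    have -> : N * (del * N ^+ 2) * (5 * eta) = del * N ^+ 2 * (5 * eta * N) by ring.
    by rewrite ler_wpM2l // mulr_ge0 ?sqr_ge0 ?ltW.
  have [w0 w0W] := card_gt0P WW0.
  apply: ltr_sum.
    by apply/hasP; exists w0; rewrite ?mem_index_enum.
  move=> w; rewrite inE => /andP[wWt wW]; have := bad w.
  by rewrite /ok wW wWt /= -ltNge.
by rewrite ltNge big.
Qed.

(* The error grows by a factor [1 + O(1/n)] per middle vertex, hence by a bounded
   factor over the whole process. *)
Lemma packing_progress Dn UE Wt : packing e M Dn UE Wt -> eps * N <= target Wt ->
  exists Dn' UE' Wt', [/\ packing e M Dn' UE' Wt', (#|Wt'| = #|Wt|.+1)%N &
    excess Dn' Wt' + del3 * N ^+ 2 <=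
      (1 + 3 / (eps * N)) * (excess Dn Wt + del3 * N ^+ 2)].
Proof.
move=> pk tg; have [w [wW wWt hw]] := good_middle pk tg.
set A := [set u in M | e w u].
have T0 : 0 < target Wt by apply: lt_le_trans tg; rewrite mulr_gt0.
have D0 : 0 < p * target Wt by rewrite mulr_gt0.
(* With this value of [th] both extra error terms of the matching lemma are at most [del * N ^+ 2],
   the first one by [n_large]. *)
have th0 : 0 < del * N by rewrite mulr_gt0.
have [X [g [sX ig hg cX]]] := near_regular_matching A (unrouted_sym M Dn) D0 th0 w.
have [Dn' [UE' [pk' sumE]]] := packing_step esym pk wW wWt sX ig hg.
exists Dn', UE', (w |: Wt); split=> //; first by rewrite cardsU1 wWt.
have exE : excess Dn' (w |: Wt) + 2 * #|X|%:R = excess Dn Wt + #|A|%:R.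
  have exS D0n Wt0 : excess D0n Wt0 = (\sum_(u in M) (udeg M D0n u + degin e Wt0 u))%:R
      + \sum_(u in M) ((degin e M u)%:R + 1 - #|M|%:R).
    rewrite natr_sum -big_split /=; apply: eq_bigr => u _; rewrite natrD; ring.
  rewrite !exS addrAC -natrM -natrD sumE natrD; ring.
have degA u : u \in A -> degin (unrouted M Dn) A u = degin e [set y | unrouted M Dn u y] w.
  move=> _; apply: eq_card => y; rewrite !inE /unrouted.
  by case: (y \in M); case: (e w y); rewrite ?andbF ?andbT.
have sA : \sum_(u in A) `|(degin (unrouted M Dn) A u)%:R - p * target Wt|
    <= del * N ^+ 2 / (5 * eta) + p * (excess Dn Wt + N + 2 * (del * N ^+ 2)).
  apply: le_trans (lerD hw (ler_wpM2l (ltW p0) (udeg_deviation pk))).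
  rewrite mulr_sumr -big_split /= (eq_bigr (fun u =>
    `|(degin e [set y | unrouted M Dn u y] w)%:R - p * target Wt|)) => [|u uA]; last by rewrite degA.
  apply: le_trans (_ : \sum_(u in M) `|(degin e [set y | unrouted M Dn u y] w)%:R - p * target Wt| <= _).
    rewrite [leRHS](big_setID A) /= (setIidPr _) ?lerDl ?sumr_ge0 //.
    by apply/subsetP => u; rewrite inE => /andP[].
  apply: ler_sum => u _; set a := (degin e _ w)%:R; set b := (udeg M Dn u)%:R.
  have -> : a - p * target Wt = (a - p * b) + p * (b - target Wt) by ring.
  by apply: le_trans (ler_normD _ _) _; rewrite lerD2l normrM (gtr0_norm p0).
have AN : #|A|%:R <= N by rewrite ler_nat -[X in (_ <= X)%N]card_ord max_card.
have AA : #|A|%:R ^+ 2 / (del * N) + del * N * #|A|%:R <= 2 * (del * N ^+ 2).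
  have a1 : #|A|%:R ^+ 2 / (del * N) <= del * N ^+ 2.
    rewrite ler_pdivrMr //; apply: le_trans (_ : N ^+ 2 <= _).
      by rewrite ler_pXn2r ?nnegrE // ltW.
    have -> : del * N ^+ 2 * (del * N) = (del ^+ 2 * N) * N ^+ 2 by ring.
    by rewrite ler_peMl // sqr_ge0.
  have a2 : del * N * #|A|%:R <= del * N ^+ 2.
    by rewrite expr2 mulrA ler_wpM2l // ltW.
  by rewrite (le_trans (lerD a1 a2)) // -mulr2n mulr_natl.
have ex0 : 0 <= excess Dn Wt.
  apply: sumr_ge0 => u uM; rewrite subr_ge0 -!natrD natr1 -addn1 ler_nat.
  exact: pk_miss pk _ uM.
set Y := excess Dn Wt + del3 * N ^+ 2.
have k0 : 0 <= del * N ^+ 2 by rewrite mulr_ge0 ?sqr_ge0 ?ltW.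
have C0 : 0 < C by rewrite -(pmulr_lgt0 _ p0); apply: lt_le_trans Cp.
have fin : del * N ^+ 2 / (5 * eta) + p * (excess Dn Wt + N + 2 * (del * N ^+ 2)) + 2 * (del * N ^+ 2)
   <= p * Y.
  rewrite /Y /del3.
  have -> : del * (3 + C * (2 + (5 * eta)^-1)) * N ^+ 2
     = del * N ^+ 2 * (3 + C * (2 + (5 * eta)^-1)) by ring.
  have i0 : 0 <= (5 * eta)^-1 by rewrite invr_ge0 mulr_ge0 ?ltW.
  have h1 := small1; move: k0 h1; set k := del * N ^+ 2; set i := (5 * eta)^-1 in i0 *.
  move=> k0 h1; have h2 : 0 <= (C * p - 1) * (k * (2 + i)).
    by rewrite mulr_ge0 ?subr_ge0 // mulr_ge0 // addr_ge0.
  have h3 : 0 <= p * (k - N) by rewrite mulr_ge0 ?subr_ge0 // ltW.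
  lra.
have Y0 : 0 <= Y.
  rewrite addr_ge0 // mulr_ge0 ?sqr_ge0 // /del3 mulr_ge0 ?(ltW del0) // addr_ge0 //.
  by rewrite mulr_ge0 ?(ltW C0) // addr_ge0 // invr_ge0 mulr_ge0 // ltW.
have main : (#|A|%:R - 2 * #|X|%:R) * (p * target Wt) <= 3 * (p * Y).
  apply: le_trans cX _; rewrite ler_pM2l // -addrA; apply: le_trans fin.
  by rewrite lerD.
have {}main : #|A|%:R - 2 * #|X|%:R <= 3 / (eps * N) * Y.
  have [neg|pos] := lerP (#|A|%:R - 2 * #|X|%:R : R) 0.
    by apply: (le_trans neg); rewrite !mulr_ge0 // invr_ge0 mulr_ge0 ?ltW.
  have eN : 0 < eps * N by rewrite mulr_gt0.
  rewrite mulrAC ler_pdivlMr //.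
  apply: le_trans (_ : (#|A|%:R - 2 * #|X|%:R) * target Wt <= _).
    by rewrite ler_pM2l.
  by rewrite -(ler_pM2l p0); move: main; lra.
by rewrite mulrDl mul1r; move: exE main; rewrite /Y; lra.
Qed.

Variable Q : R.
Hypothesis growth : forall t, (t <= n)%N -> (1 + 3 / (eps * N)) ^+ t <= Q.
Hypothesis del3_small : del3 * Q <= eps.

Let del3_ge : 3 * del <= del3.
Proof.
have C0 : 0 < C by rewrite -(pmulr_lgt0 _ p0); apply: lt_le_trans Cp.
rewrite /del3 mulrC ler_pM2l // lerDl mulr_ge0 ?(ltW C0) // addr_ge0 //.
by rewrite invr_ge0 mulr_ge0 // ltW.
Qed.

Lemma packing_iterate k : exists Dn UE Wt, [/\ packing e M Dn UE Wt,
  excess Dn Wt + del3 * N ^+ 2 <= del3 * N ^+ 2 * (1 + 3 / (eps * N)) ^+ #|Wt| &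
  #|Wt| = k \/ target Wt < eps * N].
Proof.
elim: k => [|k [Dn [UE [Wt [pk hex]]]]].
  have [Dn [UE [pk deg0]]] := packing_init M esym eirr.
  exists Dn, UE, set0; split; rewrite ?cards0 //; last by left.
  rewrite expr0 mulr1 gerDr /excess; apply: sumr_le0 => u uM.
  have -> : degin e set0 u = 0%N by apply: eq_card0 => y; rewrite !inE.
  by rewrite -(deg0 u uM) addr0 !natrD subrr.
case=> [ck|tg]; last by exists Dn, UE, Wt; split=> //; right.
have [tg|tg] := ltP (target Wt) (eps * N); first by exists Dn, UE, Wt; split=> //; right.
have [Dn' [UE' [Wt' [pk' c' ex']]]] := packing_progress pk tg.
exists Dn', UE', Wt'; split=> //; last by left; rewrite c' ck.
apply: (le_trans ex'); rewrite c' [_ ^+ #|Wt|.+1]exprS.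
set q := 1 + _ in hex *; set X := del3 * N ^+ 2 in hex *.
rewrite (_ : X * (q * _) = q * (X * q ^+ #|Wt|)); last by ring.
rewrite ler_pM2l // /q.
by rewrite ltr_pwDl // divr_ge0 // mulr_ge0 ?ltW.
Qed.

(** Running [n.+1] rounds would use more middle vertices than there are vertices, so the process
    stops with [target] below [eps * N]; the accumulated deviation adds at most another
    [eps * N ^+ 2]. *)
Lemma packing_end : exists Dn UE Wt, packing e M Dn UE Wt /\
  (\sum_(u in M) udeg M Dn u)%:R <= 2 * eps * N ^+ 2.
Proof.
have [Dn [UE [Wt [pk hex]]]] := packing_iterate n.+1.
have cW : (#|Wt| <= n)%N by rewrite -[X in (_ <= X)%N]card_ord max_card.
case=> [cW'|tg]; first by rewrite cW' ltnn in cW.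
exists Dn, UE, Wt; split=> //.
have h1 := udeg_deviation pk.
have h2 : del3 * N ^+ 2 * (1 + 3 / (eps * N)) ^+ #|Wt| <= eps * N ^+ 2.
  rewrite mulrAC ler_wpM2r ?sqr_ge0 //; apply: le_trans del3_small.
  rewrite ler_wpM2l ?growth //; apply: le_trans del3_ge.
  by rewrite mulr_ge0 // ltW.
have h3 : 3 * del * N ^+ 2 <= del3 * N ^+ 2 by rewrite ler_wpM2r ?sqr_ge0.
have h4 : (\sum_(u in M) udeg M Dn u)%:R <= \sum_(u in M) (eps * N)
    + \sum_(u in M) `|(udeg M Dn u)%:R - target Wt|.
  rewrite natr_sum -big_split /=; apply: ler_sum => u _.
  have := ler_norm ((udeg M Dn u)%:R - target Wt); lra.
have h5 : \sum_(u in M) (eps * N) <= eps * N ^+ 2.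
  rewrite sumr_const -[leLHS]mulr_natr -mulrA expr2 ler_pM2l //.
  by rewrite ler_wpM2l // ltW.
have := small1; move: h1 h2 h3 h4 h5 hex; lra.
Qed.

Hypothesis link_small : 2 * eps + del < 25 * eta ^+ 2 * p ^+ 3.

(** Two sets of at least [5 * eta * d] free stubs have at least
    [p * (5 * eta * d) ^ 2 - del * N ^ 2] adjacencies, which by [link_small] exceeds twice the
    number of edges ever used inside [W]. Initially no such edge is used. *)
Lemma dense_complete : exists Dn UE, routed e Dn UE /\
  forall x y, x \in M -> y \in M -> x != y -> [set x; y] \in Dn.
Proof.
have [Dn [UE [Wt [pk udegN]]]] := packing_end.
apply: (@greedy_finish _ e M esym d (\sum_(u in M) udeg M Dn u) _ _ Dn UE) => //.
- move=> UE0 A A' sA sA' cA cA' hB.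
  pose P w w' := [&& w \in A, w' \in A', e w w' & [set w; w'] \notin UE0].
  have [/existsP[w /existsP[w' /and4P[]]]|none] := boolP [exists w, [exists w', P w w']].
    by exists w, w'.
  have all_used w w' : w \in A -> w' \in A' -> e w w' -> [set w; w'] \in UE0.
    move=> wA wA' eww; move/existsPn: none => /(_ w)/existsPn/(_ w').
    by rewrite /P wA wA' eww /= negbK.
  have := innerW_dominates eirr sA sA' all_used.
  move=> /leq_trans/(_ hB); rewrite -(ler_nat R) => /le_trans/(_ udegN).
  have c1 (S : {set 'I_n}) : (d < #|S| + #|M|)%N -> 5 * eta * d%:R <= #|S|%:R :> R.
    by move=> /ltnW; rewrite -(ler_nat R) natrD; move: slack; lra.
  have mA : p * #|A'|%:R * #|A|%:R - del * N ^+ 2 <= (\sum_(w in A) degin e A' w)%:R.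
    rewrite lerBlDr natr_sum; apply: le_trans (_ : \sum_(w in A) (degin e A' w)%:R +
      \sum_(w in A) `|(degin e A' w)%:R - p * #|A'|%:R| <= _).
      rewrite -big_split mulr_natr -sumr_const; apply: ler_sum => w _ /=.
      have := ler_norm (- ((degin e A' w)%:R - p * #|A'|%:R)); rewrite normrN; lra.
    rewrite lerD2l; apply: le_trans (mix A'); rewrite [leRHS](bigID (mem A)) /= lerDl.
    exact: sumr_ge0.
  move=> hub; have {mA}mA := le_trans mA hub.
  have d0 : 0 <= 5 * eta * d%:R by rewrite !mulr_ge0 // ltW.
  have prodA : p * (5 * eta * d%:R) ^+ 2 <= p * #|A'|%:R * #|A|%:R.
    by rewrite -[leRHS]mulrA ler_pM2l // expr2 ler_pM // c1.
  have : (2 * eps + del) * N ^+ 2 < 25 * eta ^+ 2 * p ^+ 3 * N ^+ 2.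
    by rewrite ltr_pM2r // exprn_gt0.
  have -> : 25 * eta ^+ 2 * p ^+ 3 * N ^+ 2 = p * (5 * eta * d%:R) ^+ 2.
    by rewrite dE; ring.
  by move: prodA mA; lra.
- exact: pk_routed pk.
- by move=> u uM; apply: pk_stubs pk _ uM.
suff -> : #|innerW M UE| = 0%N by rewrite muln0 add0n.
apply: eq_card0 => f; rewrite inE; apply/negP => /and3P[fU fW /cards2P[w [w' [_ fE]]]].
have /subsetP sf := fW.
have wW : w \in W by apply: sf; rewrite fE set21.
have wW' : w' \in W by apply: sf; rewrite fE set22.
by have := pk_WW pk wW wW'; rewrite -fE fU.
Qed.

End Dense.

(** * Numerical parameters *)

Section MixingBounds.
Variables (R : realType) (n d : nat) (lam : R) (e : rel 'I_n).
Hypotheses (G : ndl_graph d lam e) (lamd : lam < d%:R).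
Variables (s : R) (U S : {set 'I_n}).
Hypothesis s0 : 0 < s.

Lemma degin_sum_le : (\sum_(x in U) degin e S x)%:R <=
  d%:R / n%:R * #|S|%:R * #|U|%:R + lam ^+ 2 * #|S|%:R / s + s * #|U|%:R :> R.
Proof.
rewrite -addrA natr_sum; apply: le_trans (lerD (lexx _) (degin_mix U S G lamd s0)).
rewrite mulr_natr -sumr_const -big_split /=; apply: ler_sum => x _.
by rewrite -lerBlDl ler_norm.
Qed.

Lemma degin_sum_ge : d%:R / n%:R * #|S|%:R * #|U|%:R
  <= (\sum_(x in U) degin e S x)%:R + lam ^+ 2 * #|S|%:R / s + s * #|U|%:R :> R.
Proof.
rewrite -addrA natr_sum; apply: le_trans (lerD (lexx _) (degin_mix U S G lamd s0)).
rewrite mulr_natr -sumr_const -big_split /=; apply: ler_sum => x _.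
by rewrite -lerBlDl -[leLHS]opprB -normrN ler_norm.
Qed.

End MixingBounds.

(** * Choice of the parameters of the sparse case *)

Section SparseNumbers.
Variables (R : realType) (n d : nat) (lam eta : R) (e : rel 'I_n) (M : {set 'I_n}).
Hypotheses (G : ndl_graph d lam e) (lamd : lam < d%:R).
Local Notation D := (d%:R : R).
Local Notation N := (n%:R : R).
Hypotheses (eta0 : 0 < eta) (eta5 : eta < 1 / 5) (eta_d : 1 <= eta * D).
Hypothesis lam_small : 1000 * (1000 * (25 * lam ^+ 2)) <= eta ^+ 2 * D ^+ 2.
Hypothesis slack : 5 * eta * D <= D - #|M|%:R.
Hypothesis nd : 16 * D <= N.
Hypothesis d160 : (160 <= d)%N.

Let k := (d %/ 20)%N.
Let Q0 := (Num.truncn (eta * D)).+1.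
Let Dead := [set w in ~: M | (d < 8 * degin e M w)%N].
Let m0 := (n %/ 160)%N.

Let esym : symmetric e. Proof. by have [[]] := G. Qed.
Let eirr : irreflexive e. Proof. by have [[]] := G. Qed.
Let reg u : #|[set w | e u w]| = d. Proof. by have [_ []] := G. Qed.

Let D0 : 0 < D. Proof. by rewrite ltr0n (leq_trans _ d160). Qed.
Let N0 : 0 < N. Proof. by apply: lt_le_trans nd; rewrite mulr_gt0. Qed.

Let k_le : 20 * k%:R <= D.
Proof. by rewrite -natrM ler_nat /k mulnC leq_divM. Qed.

Let k_ge : D <= 40 * k%:R.
Proof. by rewrite -natrM ler_nat /k; move: d160; clear; lia. Qed.

Let k0 : 0 < k%:R :> R.
Proof. by move: D0 k_ge; lra. Qed.

Let Q0_le : Q0%:R <= eta * D + 1.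
Proof.
rewrite /Q0 -natr1 lerD2r.
by have /andP[] := truncn_itv (ltW (mulr_gt0 eta0 D0)).
Qed.

Let Q0_ge : eta * D <= Q0%:R.
Proof. by have /andP[_ /ltW] := truncn_itv (ltW (mulr_gt0 eta0 D0)). Qed.

Let M_le : #|M|%:R <= D.
Proof. by move: slack eta_d; lra. Qed.

Let lam_eta : 1000 * (1000 * (125 * lam ^+ 2)) <= eta * D ^+ 2.
Proof.
have h : eta * (eta * D ^+ 2) <= 1 / 5 * (eta * D ^+ 2).
  by rewrite ler_wpM2r ?mulr_ge0 ?sqr_ge0 // ltW.
by move: lam_small h; lra.
Qed.

Let lam_D : 1000 * (1000 * (625 * lam ^+ 2)) <= D ^+ 2.
Proof.
have h : eta * D ^+ 2 <= 1 / 5 * D ^+ 2 by rewrite ler_pM2r ?exprn_gt0 // ltW.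
by move: lam_eta h; lra.
Qed.

Let L0 : 0 <= lam ^+ 2. Proof. exact: sqr_ge0. Qed.

Let MDead_disj : [disjoint M & Dead].
Proof.
by rewrite disjoint_subset; apply/subsetP => x xM; rewrite !inE xM.
Qed.

(** Each vertex of [Dead] sees more than [d / 8] of [M], while the expected number is
    [d * #|M| / n <= d / 16]; the spectral bound makes such deviations rare. *)
Let dead_small : 2 * #|Dead|%:R <= eta * D.
Proof.
have s0 : 0 < D / 32 by rewrite divr_gt0.
have h := degin_sum_le G lamd Dead M s0.
have h1 : D / 8 * #|Dead|%:R <= (\sum_(x in Dead) degin e M x)%:R.
  rewrite natr_sum mulr_natr -sumr_const; apply: ler_sum => x.
  rewrite !inE => /andP[_ /ltnW]; rewrite -(ler_nat R) natrM; lra.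
have h2 : D / N * #|M|%:R * #|Dead|%:R <= D / 16 * #|Dead|%:R.
  rewrite ler_wpM2r // mulrAC ler_pdivrMr //.
  apply: le_trans (_ : D * D <= _); first by rewrite ler_pM2l.
  rewrite -mulrA ler_pM2l //; move: nd; lra.
have h3 : lam ^+ 2 * #|M|%:R / (D / 32) <= 32 * lam ^+ 2.
  rewrite ler_pdivrMr // (_ : 32 * lam ^+ 2 * (D / 32) = lam ^+ 2 * D); last by field.
  by rewrite ler_wpM2l.
have h4 : D * #|Dead|%:R <= 1024 * lam ^+ 2 by lra.
have h5 : D * (2 * #|Dead|%:R) <= D * (eta * D) by move: lam_eta L0; lra.
by rewrite ler_pM2l in h5.
Qed.

Let degZ (x : 'I_n) : D - (degin e M x)%:R - #|Dead|%:R <= (degin e (~: (M :|: Dead)) x)%:R.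
Proof.
rewrite !lerBlDr -!natrD ler_nat -(reg x).
apply: leq_trans (_ : #|[set y in ~: (M :|: Dead) | e x y] :|: [set y in M | e x y] :|: Dead| <= _)%N.
  apply/subset_leq_card/subsetP => y; rewrite inE => exy.
  apply/setUP; have [yD|yD] := boolP (y \in Dead); [by right | left].
  apply/setUP; have [yM|yM] := boolP (y \in M); [right|left].
    by rewrite inE yM.
  by rewrite inE exy in_setC in_setU (negPf yM) (negPf yD).
apply: leq_trans (leq_card_setU _ _) _; rewrite addnAC leq_add2r.
by apply: leq_trans (leq_card_setU _ _) _; rewrite addnC.
Qed.

(** At a branch vertex the slack [5 * eta * d] pays for [Q0 <= 2 * eta * d], for dead neighbours, at
    most [eta * d / 2], and for the surplus [2 * eta * d]. *)
Let demand_le x : x \in ~: Dead ->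
  (demand e M k Q0 x)%:R + 2 * eta * D <= (degin e (~: (M :|: Dead)) x)%:R.
Proof.
move=> xD; apply: le_trans (degZ x); have h := dead_small.
rewrite /demand; case: ifP => xM.
  rewrite natrD natrB; last by apply/subset_leq_card/subsetP => y; rewrite inE => /andP[].
  move: slack Q0_le eta_d h; lra.
have h8 : 8 * (degin e M x)%:R <= D.
  by move: xD; rewrite !inE xM /= -leqNgt -(ler_nat R) natrM.
have h9 : eta * D <= 1 / 5 * D by rewrite ler_pM2r // ltW.
rewrite natrM; move: D0 k_le h h8 h9; lra.
Qed.

(** Only the heads in [Y] can lose by the cap [k]. Mixing bounds the adjacencies between [Y] and [U]
    by [k * #|Y| + eta * D * #|U|], so half of the surplus in [demand_le] survives. *)
Lemma room_ge (U : {set 'I_n}) : U \subset ~: Dead -> (#|U| <= 2 * m0)%N ->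
  (\sum_(x in U) demand e M k Q0 x)%:R + eta * D * #|U|%:R
    <= (room e (cap M Dead k) set0 U)%:R.
Proof.
move=> sU cU; pose Y := [set y in ~: (M :|: Dead) | (k <= degin e U y)%N].
have h1 : (k%:R * #|Y|%:R + (\sum_(x in U) degin e (~: (M :|: Dead)) x)%:R : R)
    <= (room e (cap M Dead k) set0 U + \sum_(y in Y) degin e U y)%:R.
  rewrite -natrM -natrD ler_nat.
  have -> : (\sum_(x in U) degin e (~: (M :|: Dead)) x
      = \sum_(y in ~: (M :|: Dead)) degin e U y)%N.
    by apply/eqP; rewrite -(eqr_nat R) !natr_sum; apply/eqP; exact: double_count.
  rewrite mulnC -sum_nat_const.
  rewrite [X in (X + _ <= _)%N]big_mkcond [X in (_ + X <= _)%N]big_mkcond.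
  rewrite [X in (_ <= _ + X)%N]big_mkcond -!big_split; apply: leq_sum => y _ /=.
  have -> : indeg set0 y = 0%N by rewrite /indeg eq_card0 // => x; rewrite !inE.
  have -> : freedeg e set0 U y = degin e U y.
    by apply: eq_card => x; rewrite !inE andbT esym.
  rewrite subn0 /cap ![y \in Y]inE !in_setC.
  case: (y \in M :|: Dead) => /=; first by rewrite !addn0.
  by case: (leqP k (degin e U y)) => h; rewrite ?add0n ?addn0.
have h2 : (\sum_(x in U) demand e M k Q0 x)%:R + 2 * eta * D * #|U|%:R
    <= (\sum_(x in U) degin e (~: (M :|: Dead)) x)%:R :> R.
  rewrite !natr_sum mulr_natr -sumr_const -big_split /=; apply: ler_sum => x xU.
  exact: demand_le (subsetP sU x xU).
have s0 : 0 < k%:R / 2 :> R by rewrite divr_gt0.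
have h3 := degin_sum_le G lamd Y U s0.
have h4 : D / N * #|U|%:R * #|Y|%:R <= k%:R / 2 * #|Y|%:R.
  rewrite ler_wpM2r // mulrAC ler_pdivrMr //.
  have cU' : 80 * #|U|%:R <= N :> R.
    by rewrite -natrM ler_nat; move: cU; rewrite /m0; clear; lia.
  have : 80 * (D * #|U|%:R) <= D * N by rewrite mulrCA ler_pM2l.
  have : D * N <= 40 * k%:R * N by rewrite ler_pM2r.
  lra.
have h5 : lam ^+ 2 * #|U|%:R / (k%:R / 2) <= eta * D * #|U|%:R.
  rewrite mulrAC ler_wpM2r // ler_pdivrMr //.
  have : eta * D ^+ 2 <= eta * D * (40 * k%:R) by rewrite expr2 mulrA ler_pM2l // mulr_gt0.
  by move: lam_eta L0; lra.
by move: h1 h2 h3 h4 h5; rewrite natrD; lra.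
Qed.

Let spread_ok (A2 B : {set 'I_n}) : (40 * #|B| <= n)%N ->
  (forall x, x \in A2 -> (3 * k <= degin e B x)%N) -> (13 * #|A2| <= #|B|)%N.
Proof.
move=> cB hA; rewrite -(ler_nat R) natrM.
have h := degin_sum_le G lamd A2 B k0.
have h1 : 3 * k%:R * #|A2|%:R <= (\sum_(x in A2) degin e B x)%:R :> R.
  rewrite natr_sum mulr_natr -sumr_const; apply: ler_sum => x xA.
  by rewrite -natrM ler_nat hA.
have h2 : D / N * #|B|%:R * #|A2|%:R <= k%:R * #|A2|%:R.
  rewrite ler_wpM2r // mulrAC ler_pdivrMr //.
  have cB' : 40 * #|B|%:R <= N :> R by rewrite -natrM ler_nat.
  have : 40 * (D * #|B|%:R) <= D * N by rewrite mulrCA ler_pM2l.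
  have : D * N <= 40 * k%:R * N by rewrite ler_pM2r.
  lra.
have h3 : 13 * (lam ^+ 2 * #|B|%:R / k%:R) <= k%:R * #|B|%:R.
  rewrite mulrA ler_pdivrMr // (_ : 13 * _ = 13 * lam ^+ 2 * #|B|%:R); last by ring.
  rewrite (_ : _ * k%:R = k%:R ^+ 2 * #|B|%:R); last by ring.
  rewrite ler_wpM2r //.
  have : D ^+ 2 <= (40 * k%:R) ^+ 2 by rewrite ler_pXn2r ?nnegrE ?mulr_ge0 // ltW.
  by move: lam_D L0; lra.
have : k%:R * (13 * #|A2|%:R) <= k%:R * #|B|%:R :> R by lra.
by rewrite ler_pM2l.
Qed.

Let joined_ok (A B : {set 'I_n}) : (n < 240 * #|A|)%N -> (n < 240 * #|B|)%N ->
  D * N <= 240 * (500 * (\sum_(x in A) degin e B x)%:R).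
Proof.
rewrite -2!(ltr_nat R) !natrM => cA cB.
have s0 : 0 < D / 960 by rewrite divr_gt0.
have h := degin_sum_ge G lamd A B s0.
have h1 : D * #|A|%:R <= 240 * (D / N * #|B|%:R * #|A|%:R).
  have i : D <= 240 * (D / N * #|B|%:R).
    rewrite (_ : 240 * _ = D * (240 * #|B|%:R) / N); last by ring.
    by rewrite ler_pdivlMr // ler_pM2l // ltW.
  by rewrite [leRHS]mulrA ler_wpM2r.
have h2 : lam ^+ 2 * #|B|%:R / (D / 960) <= D * #|A|%:R / 960.
  rewrite ler_pdivrMr //.
  have BN : #|B|%:R <= N by rewrite ler_nat -[X in (_ <= X)%N]card_ord max_card.
  have i1 : lam ^+ 2 * #|B|%:R <= lam ^+ 2 * (240 * #|A|%:R).
    by rewrite ler_wpM2l // (le_trans BN) // ltW.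
  have i2 : 1000 * (1000 * (625 * lam ^+ 2)) * #|A|%:R <= D ^+ 2 * #|A|%:R.
    by rewrite ler_wpM2r.
  have i3 : 0 <= lam ^+ 2 * #|A|%:R by rewrite mulr_ge0.
  have -> : D * #|A|%:R / 960 * (D / 960) = D ^+ 2 * #|A|%:R / (960 * 960) by field.
  rewrite ler_pdivlMr //; lra.
have h3 : D * N <= D * (240 * #|A|%:R) by rewrite ler_pM2l // ltW.
have h4 : 0 <= (\sum_(x in A) degin e B x)%:R :> R by [].
move: h h1 h2 h3 h4; set X := D / N * _ * _; set Y := lam ^+ 2 * _ / _.
by lra.
Qed.

Let H := (trunc_log 2 (n %/ Q0)).+1.
Hypothesis eta_D : 3840 <= eta * D.
Hypothesis n_large : 1000 * (1000 * (32 * (1000 * 1000))) * D <= eta ^+ 3 * N.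

Let Q0_le_n : (Q0 <= n)%N.
Proof.
rewrite -(ler_nat R); apply: (le_trans Q0_le).
have h : eta * D <= 1 / 5 * D by rewrite ler_pM2r // ltW.
have := D0; move: nd eta_D h; lra.
Qed.

Let sq_le_exp2 (i : nat) : ((i + 3) ^ 2 <= 32 * 2 ^ i)%N.
Proof.
elim: i => // i IH; rewrite [(2 ^ i.+1)%N]expnS mulnCA.
apply: leq_trans (_ : 2 * (i + 3) ^ 2 <= _)%N; last by rewrite leq_mul2l.
by rewrite -!mulnn; clear; nia.
Qed.

(** The logarithm is replaced by a square root: [sq_le_exp2] at [i = H - 1] gives
    [(H + 2) ^ 2 * Q0 <= 32 * n]. Squaring the claim then leaves exactly the condition [n_large], of
    order [eta ^ -3]. *)
Let H_le : 1000 * (1000 * ((H + 2)%:R * D)) <= eta * N.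
Proof.
have Q00 : (0 < n %/ Q0)%N by rewrite divn_gt0.
have h1 : ((H + 2) ^ 2 * Q0 <= 32 * n)%N.
  apply: leq_trans (_ : 32 * 2 ^ (trunc_log 2 (n %/ Q0)) * Q0 <= _)%N.
    by rewrite leq_mul2r /H addSnnS sq_le_exp2 orbT.
  rewrite -mulnA leq_mul2l /=; apply: leq_trans (leq_divM n Q0).
  by rewrite leq_mul2r trunc_logP ?orbT.
have {}h1 : (H + 2)%:R ^+ 2 * (eta * D) <= 32 * N.
  apply: le_trans (_ : (H + 2)%:R ^+ 2 * Q0%:R <= _); first by rewrite ler_wpM2l ?sqr_ge0 ?Q0_ge.
  by rewrite -natrX -!natrM ler_nat.
have e0 := eta0; have d0 := D0; have n0 := N0.
rewrite -(@ler_pXn2r _ 2) ?nnegrE ?mulr_ge0 ?(ltW e0) ?(ltW n0) ?(ltW d0) //.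
have k0' : 0 < eta * D by rewrite mulr_gt0.
rewrite -(ler_pM2r k0').
have g1 : 1000 * (1000 * (32 * (1000 * 1000))) * D * (N * D)
    <= eta ^+ 3 * N * (N * D) by rewrite ler_wpM2r // mulr_ge0 // ltW.
have g2 : (H + 2)%:R ^+ 2 * (eta * D) * (D * D) <= 32 * N * (D * D).
  by rewrite ler_wpM2r // mulr_ge0 // ltW.
rewrite (_ : _ * (eta * D) = 1000 * (1000 * (1000 * 1000)) *
   ((H + 2)%:R ^+ 2 * (eta * D) * (D * D))); last by ring.
rewrite (_ : (eta * N) ^+ 2 * (eta * D) = eta ^+ 3 * N * (N * D)); last by ring.
apply: le_trans g1; rewrite (_ : _ * D * (N * D) =
  1000 * (1000 * (1000 * 1000)) * (32 * N * (D * D))); last by ring.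
by apply: ler_wpM2l g2; rewrite !mulr_ge0.
Qed.

Let budget_le : (budget M H)%:R <= (H + 2)%:R * D ^+ 2.
Proof.
rewrite /budget !natrM ler_wpM2l // expr2.
by rewrite ler_pM.
Qed.

Lemma sparse_routed : exists Dn UE, routed e Dn UE /\
  forall x y, x \in M -> y \in M -> x != y -> [set x; y] \in Dn.
Proof.
have h1 : (H + 2)%:R * D ^+ 2 <= eta * D * N / (1000 * 1000).
  have : D * (1000 * (1000 * ((H + 2)%:R * D))) <= D * (eta * N) by rewrite ler_pM2l.
  lra.
have nN : (2560 <= n)%N.
  rewrite -(ler_nat R); apply: le_trans nd.
  by rewrite -natrM ler_nat (leq_trans (_ : _ <= 16 * 160)%N) // leq_mul2l.
have m0_ge : N <= 320 * m0%:R by rewrite -natrM ler_nat /m0; move: nN; clear; lia.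
(* As 3840 is 6 times 640, the term [6 * n] takes at most half of [eta * D * N / 320], a lower bound
   for the surplus in [room_ge] on sets of size [m0]. *)
have eDN : 3840 * N <= eta * D * N by rewrite ler_pM2r.
apply: (@sparse_complete 'I_n e M Dead k Q0 H m0 (budget M H + 6 * n)) => //;
  rewrite ?card_ord //.
- by rewrite /m0; move: nN; clear; lia.
- apply/extendableP => U sU cU; rewrite -(ler_nat R) natrD.
  have := room_ge sU cU; have : 0 <= eta * D * #|U|%:R by rewrite !mulr_ge0 // ltW.
  have : 0 <= (\sum_(x in U) outdeg set0 x)%:R :> R by [].
  lra.
- move=> U sU /andP[mU cU]; rewrite -(ltr_nat R) 2!natrD.
  apply: lt_le_trans (room_ge sU cU); rewrite ltrD2l.
  apply: lt_le_trans (_ : eta * D * m0%:R <= _); last first.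
    by rewrite ler_pM2l ?mulr_gt0 // ler_nat.
  have : eta * D * N <= eta * D * (320 * m0%:R) by rewrite ler_pM2l ?mulr_gt0.
  rewrite natrM; have := budget_le; have := N0; move: h1 eDN; lra.
- by rewrite /k; move: d160; clear; lia.
- rewrite -ltn_divLR //; exact: trunc_log_ltn.
move=> A B cA cB; have hj := joined_ok cA cB; rewrite -(ltr_nat R) natrM.
have D2 : 0 < D * N by rewrite mulr_gt0.
have h2 : eta * (D * N) <= 1 / 5 * (D * N) by rewrite ler_pM2r // ltW.
by have := budget_le; move: h1 h2 hj D2; lra.
Qed.

End SparseNumbers.

Section NdlBasics.
Variables (R : realType) (n d : nat) (lam : R) (e : rel 'I_n).
Hypothesis G : ndl_graph d lam e.

Lemma ndl_degree_le : (d <= n)%N.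
Proof.
have [_ [reg [_ [_ [i0 _]]]]] := G.
by rewrite -(reg i0) -[X in (_ <= X)%N]card_ord max_card.
Qed.

Lemma ndl_lam_ge0 : (0 < d)%N -> 0 <= lam.
Proof.
have [[_ irr] [reg [mu [_ [i0 [_ mule]]]]]] := G => d0.
have /card_gt0P[j] : (0 < #|[set w | e i0 w]|)%N by rewrite reg.
rewrite inE => eij; apply: le_trans (mule j _); first exact: normr_ge0.
by apply: contraTneq eij => ->; rewrite irr.
Qed.

(** The value [n / K] for [s] bounds both error terms by [n ^ 2 / K], because
    [lam <= d / K <= n / K]. *)
Lemma ndl_mix (K : R) (S : {set 'I_n}) : (0 < d)%N -> 1 < K -> K * lam <= d%:R ->
  \sum_x `|(degin e S x)%:R - d%:R / n%:R * #|S|%:R| <= 2 / K * n%:R ^+ 2.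
Proof.
move=> d0 K1 Kl; have K0 : 0 < K by apply: lt_trans K1.
have lam0 := ndl_lam_ge0 d0; have dn := ndl_degree_le.
have n0 : 0 < n%:R :> R by rewrite ltr0n (leq_trans d0).
have lamd : lam < d%:R.
  have [->|l0] := eqVneq lam 0; first by rewrite ltr0n.
  by apply: lt_le_trans Kl; rewrite ltr_pMl // lt_def l0.
have s0 : 0 < n%:R / K by rewrite divr_gt0.
have := degin_mix setT S G lamd s0; rewrite cardsT card_ord.
rewrite (eq_bigl predT) => [/le_trans -> //|x]; last by rewrite inE.
have SN : #|S|%:R <= n%:R :> R by rewrite ler_nat -[X in (_ <= X)%N]card_ord max_card.
have lN : lam <= n%:R / K.
  by rewrite ler_pdivlMr // mulrC (le_trans Kl) // ler_nat.
have h : lam ^+ 2 * #|S|%:R / (n%:R / K) <= n%:R / K * n%:R.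
  rewrite ler_pdivrMr // (_ : _ * (n%:R / K) = (n%:R / K) ^+ 2 * n%:R); last by ring.
  rewrite ler_pM ?sqr_ge0 //.
  by rewrite ler_pXn2r ?nnegrE // ltW.
by apply: le_trans (lerD h (lexx _)) _; rewrite le_eqVlt; apply/orP; left; apply/eqP; ring.
Qed.

End NdlBasics.

Lemma dense_routed (R : realType) (eta C : R) : 0 < eta < 1 / 5 -> 1 <= C ->
  exists K : R, 1 < K /\ exists d0 : nat, forall d n lam (e : rel 'I_n) (M : {set 'I_n}),
    (d0 <= d)%N -> ndl_graph d lam e -> K * lam <= d%:R -> n%:R <= C * d%:R ->
    5 * eta * d%:R <= d%:R - #|M|%:R ->
    exists Dn UE, routed e Dn UE /\
      forall x y, x \in M -> y \in M -> x != y -> [set x; y] \in Dn.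
Proof.
move=> /andP[eta0 eta5] C1; have C0 : 0 < C by apply: lt_le_trans C1.
(* Since [C * p >= 1], this is at most [eta ^+ 2 * p ^+ 3], as the greedy completion requires. *)
pose eps := eta ^+ 2 / C ^+ 3.
have eps0 : 0 < eps by rewrite divr_gt0 ?exprn_gt0.
have eps1 : eps <= 1.
  rewrite ler_pdivrMr ?exprn_gt0 // mul1r; apply: le_trans (_ : 1 <= _).
    by rewrite exprn_ile1 ?(ltW eta0) //; move: eta5; lra.
  by rewrite exprn_ege1.
(* Bounds [(1 + 3 / (eps * n)) ^ t] for all [t <= n]. *)
pose Q := expR (3 / eps).
pose B := 3 + C * (2 + (5 * eta)^-1).
have Q1 : 1 <= Q by rewrite -expR0 ler_expR divr_ge0 // ltW.
have B3 : 3 <= B.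
  by rewrite lerDl mulr_ge0 ?(ltW C0) // addr_ge0 // invr_ge0 mulr_ge0 // ltW.
pose del := eps / (Q * B).
have QB3 : 3 <= Q * B by rewrite -[leLHS]mul1r ler_pM.
have QB0 : 0 < Q * B by apply: lt_le_trans QB3.
have del0 : 0 < del by rewrite divr_gt0.
have del_eps : 3 * del <= eps.
  by rewrite /del mulrCA ger_pMr // ler_pdivrMr // mul1r.
have del1 : del <= 1 by move: del_eps eps1 del0; lra.
exists (2 / del); split; first by rewrite ltr_pdivlMr // mul1r; move: del_eps eps1 del0; lra.
(* As [n >= d], this makes [del ^+ 2 * n] at least 1. *)
exists (Num.truncn (del ^- 2)).+1 => d n lam e M dd G Kl nC slack.
have K1 : 1 < 2 / del by rewrite ltr_pdivlMr // mul1r; move: del_eps eps1 del0; lra.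
have d0 : (0 < d)%N by apply: leq_trans dd.
have dn := ndl_degree_le G; have n0 : (0 < n)%N by apply: leq_trans dn.
have N0 : 0 < n%:R :> R by rewrite ltr0n.
have D0 : 0 < d%:R :> R by rewrite ltr0n.
have [[esym eirr] [reg _]] := G.
set p : R := d%:R / n%:R.
have p0 : 0 < p by rewrite divr_gt0.
have Cp : 1 <= C * p by rewrite mulrA ler_pdivlMr // mul1r.
have dE : d%:R = p * n%:R :> R by rewrite divfK // gt_eqF.
have mix (S : {set 'I_n}) : \sum_x `|(degin e S x)%:R - p * #|S|%:R| <= del * n%:R ^+ 2.
  have := ndl_mix G S d0 K1 Kl.
  by rewrite (_ : 2 / (2 / del) = del) // invf_div mulrCA divff ?mulr1 ?pnatr_eq0.
have n_large : 1 <= del ^+ 2 * n%:R.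
  rewrite -ler_pdivrMl ?exprn_gt0 // mulr1.
  have i0 : 0 <= del ^- 2 by rewrite invr_ge0 exprn_ge0 // ltW.
  have /andP[_ /ltW h] := truncn_itv i0; apply: (le_trans h).
  by rewrite ler_nat (leq_trans dd).
have growth t : (t <= n)%N -> (1 + 3 / (eps * n%:R)) ^+ t <= Q.
  move=> tn; have z0 : 0 <= 3 / (eps * n%:R) by rewrite divr_ge0 // mulr_ge0 // ltW.
  apply: le_trans (_ : expR (3 / (eps * n%:R)) ^+ t <= _).
    by rewrite lerXn2r ?nnegrE ?addr_ge0 ?expR_ge0 // expR_ge1Dx.
  rewrite -expRM_natl ler_expR (_ : t%:R * _ = 3 / eps * (t%:R / n%:R)); last first.
    by rewrite invfM; ring.
  apply: ler_piMr; first by rewrite divr_ge0 // ltW.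
  by rewrite ler_pdivrMr // mul1r ler_nat.
have del3_small : del * B * Q <= eps.
  by rewrite -mulrA [B * Q]mulrC /del divfK // gt_eqF.
have link_small : 2 * eps + del < 25 * eta ^+ 2 * p ^+ 3.
  have h : 1 <= (C * p) ^+ 3 by rewrite exprn_ege1.
  have h2 : eps <= eta ^+ 2 * p ^+ 3.
    rewrite /eps ler_pdivrMr ?exprn_gt0 // -mulrA -exprMn [p * C]mulrC.
    by rewrite ler_peMr ?sqr_ge0.
  by move: h2 del_eps eps0 del0; lra.
exact: (dense_complete esym eirr reg mix p0 Cp dE eta0 slack eps0 del0 del1 n_large growth del3_small link_small).
Qed.

Theorem theorem2 (R : realType) (eta : R) :
  0 < eta < 1 / 2 ->
  exists K : R, 0 < K /\
    exists d0 : nat, forall d : nat, (d0 <= d)%N ->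
      forall (n : nat) (lam : R) (e : rel 'I_n),
        ndl_graph d lam e -> K * lam <= d%:R ->
        has_Kimmersion e (Num.truncn ((1 - 5 * eta) * d%:R)).
Proof.
(* For [eta >= 1 / 5] the requested clique has no vertices. *)
move=> /andP[eta0 _]; have [eta5|eta5] := lerP (1 / 5) eta.
  exists 1; split=> //; exists 0%N => d _ n lam e _ _.
  rewrite (_ : Num.truncn _ = 0%N).
    by apply: (@routed_Kimmersion n e 0 set0 set0) => // [|x y]; [exact: routed0 | rewrite ltn0 andbF].
  apply/truncn0Pn; rewrite -ltNge; apply: le_lt_trans ltr01.
  by rewrite mulr_le0_ge0 //; move: eta5; lra.
pose C := 1000 * (1000 * (32 * (1000 * 1000))) / eta ^+ 3.
have e3 : 0 < eta ^+ 3 by rewrite exprn_gt0.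
have C16 : 16 <= C.
  rewrite ler_pdivlMr //; have : eta ^+ 3 <= 1 by rewrite exprn_ile1 ?(ltW eta0) //; move: eta5; lra.
  by lra.
have [||K1 [K11 [d1 dense]]] := @dense_routed R eta C; [by rewrite eta0 | by move: C16; lra |].
(* Then [eta ^ 2 * K2 ^ 2 = 25 * 1000 * 1000], the constant in [lam_small]. *)
pose K2 := 5 * 1000 / eta.
have K20 : 0 < K2 by rewrite divr_gt0 ?mulr_gt0.
exists (K1 + K2); split; first by rewrite addr_gt0 // (lt_trans _ K11).
exists (d1 + 160 + (Num.truncn (3840 / eta)).+1)%N => d dd n lam e G Kl.
have d1d : (d1 <= d)%N by move: dd; clear; lia.
have d160 : (160 <= d)%N by move: dd; clear; lia.
have D0 : 0 < d%:R :> R by rewrite ltr0n (leq_trans _ d160).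
have eta_D : 3840 <= eta * d%:R.
  rewrite mulrC -ler_pdivrMr //.
  have /andP[_ /ltW h] := truncn_itv (divr_ge0 (ler0n R 3840) (ltW eta0)).
  by apply: (le_trans h); rewrite ler_nat; apply: leq_trans dd; exact: leq_addl.
have d0 : (0 < d)%N by rewrite (leq_trans _ d160).
have lam0 := ndl_lam_ge0 G d0.
have Kl1 : K1 * lam <= d%:R by apply: le_trans Kl; rewrite ler_wpM2r // lerDl ltW.
have Kl2 : K2 * lam <= d%:R.
  by apply: le_trans Kl; rewrite ler_wpM2r // lerDr ltW // (lt_trans _ K11).
have lamd : lam < d%:R.
  have [->|l0] := eqVneq lam 0; first by [].
  by apply: lt_le_trans Kl1; rewrite ltr_pMl // lt_def l0.
set m := Num.truncn _.
have me : 0 <= (1 - 5 * eta) * d%:R by rewrite mulr_ge0 //; move: eta5; clear; lra.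
have mD : m%:R <= (1 - 5 * eta) * d%:R by have /andP[] := truncn_itv me.
have mn : (m <= n)%N.
  apply: leq_trans (ndl_degree_le G); rewrite -(ler_nat R) (le_trans mD) //.
  by rewrite ger_pMl //; move: eta0; clear; lra.
pose M := [set x : 'I_n | (x < m)%N].
have cM : #|M| = m.
  have -> : M = [set widen_ord mn i | i : 'I_m].
    apply/setP => x; rewrite inE; apply/idP/imsetP => [xm|[i _ ->]]; last exact: (ltn_ord i).
    by exists (Ordinal xm) => //; apply: val_inj.
  have /card_imset -> : injective (widen_ord mn).
    by move=> i j /(congr1 val) /= h; apply: val_inj.
  exact: card_ord.
have slack : 5 * eta * d%:R <= d%:R - #|M|%:R by rewrite cM; move: mD; clear; lra.
suff [Dn [UE [rD full]]] : exists Dn UE, routed e Dn UE /\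
    forall x y, x \in M -> y \in M -> x != y -> [set x; y] \in Dn.
  apply: (routed_Kimmersion mn rD) => x y /andP[xy ym]; apply: full.
  - by rewrite inE (ltn_trans xy).
  - by rewrite inE.
  - by rewrite neq_ltn xy.
have [nC|Cn] := lerP (n%:R : R) (C * d%:R); first exact: (dense _ _ _ _ _ d1d G Kl1 nC slack).
apply: (sparse_routed (eta := eta) G lamd) => //.
- by move: eta_D; clear; lra.
- have h : (K2 * lam) ^+ 2 <= d%:R ^+ 2.
    have k0 : 0 <= K2 * lam by rewrite mulr_ge0 // ltW.
    by rewrite !expr2 ler_pM.
  have e2 : 0 < eta ^+ 2 by rewrite exprn_gt0.
  have : eta ^+ 2 * (K2 * lam) ^+ 2 <= eta ^+ 2 * d%:R ^+ 2 by rewrite ler_pM2l.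
  have -> : eta ^+ 2 * (K2 * lam) ^+ 2 = 1000 * (1000 * (25 * lam ^+ 2)).
    by rewrite -exprMn [eta * _]mulrA [eta * K2]mulrC divfK ?gt_eqF //; ring.
  by [].
- by apply: le_trans (ltW Cn); rewrite ler_pM2r.
- by rewrite [leRHS]mulrC -ler_pdivrMr // [leLHS]mulrAC ltW.
Qed.
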